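(* For all integers $m,n\ge-1$ with $m+n\ge1$, the following diagram commutes: $$\begin{array}{ccc}\mathcal M_{m,n}&\subset&J_{m+n}\mathcal M\\ {\scriptstyle\tau_{m,n}}\downarrow&&\downarrow{\scriptstyle\tau_{m+n}}\\ D_{m,n}(A,B)&\xrightarrow{\ j\ }&D_{m+n}(H).\end{array}$$ In other words, $\tau_{m+n}|_{\mathcal M_{m,n}}=j\circ\tau_{m,n}$.
   Context: Let $g\ge0$ be an integer. Let $S^3=V\cup V'$ be the standard Heegaard splitting of genus $g$ ($V,V'$ handlebodies of genus $g$ with $\partial V=\partial V'$). Fix a disk $D\subset\partial V$, and let $\Sigma$ be the compact connected oriented surface of genus $g$ with one boundary component such that $\partial V=\Sigma\cup D$; fix $*\in\partial\Sigma$. $K=\pi_1(\Sigma,* )$ is free with free basis $\{x_i,y_i\}_{1\le i\le g}$ given by the standard meridians $x_i$ (bounding disks in $V$) and parallels $y_i$ (bounding disks in $V'$), chosen so that the inverse of the class of the boundary loop is $\prod_{i=1}^g[x_i^{-1},y_i^{-1}]$. Let $\bar X=\ker(K\to\pi_1(V,* ))=\langle\langle x_1,\dots,x_g\rangle\rangle_K$ and $\bar Y=\ker(K\to\pi_1(V',* ))=\langle\langle y_1,\dots,y_g\rangle\rangle_K$. $\mathcal M$ is the group of isotopy classes of orientation-preserving homeomorphisms of $\Sigma$ fixing $\partial\Sigma$ pointwise; it acts on $K$. Write $[a,b]=aba^{-1}b^{-1}$, $[h,k]=h(k)k^{-1}$ for $h\in\mathcal M$, $k\in K$; $\Gamma_\bullet$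 is the lower central series. $\mathbb N^2_+=\mathbb N^2\setminus\{(0,0)\}$. Double lower central series: $K_{0,0}=K$, $K_{m,0}=\Gamma_m\bar X$ and $K_{0,n}=\Gamma_n\bar Y$ for $m,n\ge1$, $K_{m,n}=[K_{1,0},K_{m-1,n}][K_{0,1},K_{m,n-1}]$ for $m,n\ge1$; extended by $K_{m,n}=K_{\max(0,m),\max(0,n)}$ for $(m,n)\in\mathbb Z^2$. For $(m,n)\in\mathbb N^2$, $K_{>(m,n)}=K_{m+1,n}K_{m,n+1}$ and $\bar K_{m,n}=K_{m,n}/K_{>(m,n)}$. For $m,n\ge-1$, $\mathcal M_{m,n}=\{h\in\mathcal M\mid[h^{\pm1},K_{1,0}]\subset K_{m+1,n}\text{ and }[h^{\pm1},K_{0,1}]\subset K_{m,n+1}\}$. $J_k\mathcal M=\{h\in\mathcal M\mid[h,K]\subset\Gamma_{k+1}K\}$ for $k\ge1$; one has $\mathcal M_{m,n}\subset J_{m+n}\mathcal M$ for $m,n\ge-1$, $m+n\ge1$. $H=H_1(\Sigma;\mathbb Z)$, $A=\ker(H\to H_1(V;\mathbb Z))$, $B=\ker(H\to H_1(V';\mathbb Z))$, so $H=A\oplus B$; $a_i\in A$, $b_i\in B$ are the classes of $x_i,y_i$, a symplectic basis for the intersection form $\omega$ ($\omega(a_i,b_j)=\delta_{ij}$). For a free abelian group $C$, $\mathfrak{Lie}(C)=\bigoplus_{k\ge1}\mathfrak{Lie}_k(C)$ is the free Lie algebra on $C$ in degree 1, and $D_k(C)=\ker([\ ,\ ]\colon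 C\otimes\mathfrak{Lie}_{k+1}(C)\to\mathfrak{Lie}_{k+2}(C))$. $\mathfrak{Lie}_k(H)$ is identified with $\Gamma_kK/\Gamma_{k+1}K$. The $k$-th Johnson homomorphism $\tau_k\colon J_k\mathcal M\to D_k(H)$ is $$\tau_k(h)=\sum_{i=1}^ga_i\otimes[h,y_i]\Gamma_{k+2}K-\sum_{i=1}^gb_i\otimes[h,x_i]\Gamma_{k+2}K.$$ $\mathfrak{Lie}(A,B)=\bigoplus_{(m,n)\in\mathbb N^2_+}\mathfrak{Lie}_{m,n}(A,B)$ is the Lie algebra over $\mathbb Z$ freely generated by $A$ in degree $(1,0)$ and $B$ in degree $(0,1)$, identified with $\bigoplus\bar K_{m,n}$ via $a_i\mapsto x_iK_{>(1,0)}$, $b_i\mapsto y_iK_{>(0,1)}$. Groups $D_{m,n}(A,B)$: for $(m,n)\in\mathbb N^2_+$, $D_{m,n}(A,B)$ is the kernel of the Lie bracket map $(A\otimes\mathfrak{Lie}_{m,n+1}(A,B))\oplus(B\otimes\mathfrak{Lie}_{m+1,n}(A,B))\to\mathfrak{Lie}_{m+1,n+1}(A,B)$; for $m\ge2$, $D_{m,-1}(A,B)=D_{m-1}(A)$; for $n\ge2$, $D_{-1,n}(A,B)=D_{n-1}(B)$. Homomorphisms $\tau_{m,n}\colon\mathcal M_{m,n}\to D_{m,n}(A,B)$: for $(m,n)\in\mathbb N^2_+$, $$\tau_{m,n}(h)=\sum_{i=1}^ga_i\otimes([h,y_i]K_{>(m,n+1)})-\sum_{i=1}^gb_i\otimes([h,x_i]K_{>(m+1,n)});$$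 for $m\ge2$, $\tau_{m,-1}=\tau_{m-1}|_{\mathcal M_{m,-1}}$; for $n\ge2$, $\tau_{-1,n}=\tau_{n-1}|_{\mathcal M_{-1,n}}$ (these take values in $D_{m-1}(A)\subset D_{m-1}(H)$ and $D_{n-1}(B)\subset D_{n-1}(H)$). The homomorphism $j\colon D_{m,n}(A,B)\to D_{m+n}(H)$: for $n=-1$ or $m=-1$ it is the inclusion $D_{m-1}(A)\subset D_{m-1}(H)$ or $D_{n-1}(B)\subset D_{n-1}(H)$; for $(m,n)\in\mathbb N^2_+$ it is induced by the inclusions $A,B\subset H$ and the maps $\mathfrak{Lie}_{k,l}(A,B)\simeq\bar K_{k,l}\to\Gamma_{k+l}K/\Gamma_{k+l+1}K\simeq\mathfrak{Lie}_{k+l}(H)$, $zK_{>(k,l)}\mapsto z\Gamma_{k+l+1}K$. *)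

(* Defs.v *)
From HB Require Import structures.
From mathcomp Require Import all_boot all_order all_algebra generic_quotient ring lra.
From mathcomp Require Import all_classical all_reals all_analysis.

Set Implicit Arguments.
Unset Strict Implicit.
Unset Printing Implicit Defensive.

Import Order.TTheory GRing.Theory Num.Theory.
Import numFieldNormedType.Exports.
Local Open Scope classical_set_scope.
Local Open Scope ring_scope.
Local Open Scope quotient_scope.

Record pequiv (T : Type) := PEquiv {
  prel :> T -> T -> Prop;
  prel_refl : forall x, prel x x;
  prel_sym : forall x y, prel x y -> prel y x;
  prel_trans : forall y x z, prel x y -> prel y z -> prel x z }.

Section PropQuotient.
Variables (T : choiceType) (E : pequiv T).

Let brel : rel T := fun x y => `[< E x y >].
Let brel_refl : reflexive brel.
Proof. by move=> x; apply/asboolP/prel_refl. Qed.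
Let brel_sym : symmetric brel.
Proof. by move=> x y; apply/asbool_equiv_eq; split; apply: prel_sym. Qed.
Let brel_trans : transitive brel.
Proof.
by move=> y x z /asboolP xy /asboolP yz; apply/asboolP/(prel_trans xy yz).
Qed.

Definition pquot_rel := EquivRel brel brel_refl brel_sym brel_trans.
Definition pquot : Type := {eq_quot pquot_rel}.
HB.instance Definition _ := Choice.on pquot.

Definition cls (x : T) : pquot := \pi_({eq_quot pquot_rel}) x.
Definition rep (q : pquot) : T := repr (q : {eq_quot pquot_rel}).

Lemma repK q : cls (rep q) = q. Proof. exact: reprK. Qed.

Lemma clsP x y : cls x = cls y <-> E x y.
Proof.
split=> [/eqmodP/asboolP //|xy]; apply/eqmodP; exact/asboolP.
Qed.

Lemma rep_cls x : E (rep (cls x)) x. Proof. by apply/clsP; rewrite repK. Qed.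

Lemma pquotW (P : pquot -> Prop) : (forall x, P (cls x)) -> forall q, P q.
Proof. by move=> Pc q; rewrite -(repK q). Qed.

End PropQuotient.

Record bset (X : topologicalType) := BSet {
  carrier :> set X;
  base : X;
  base_in : carrier base }.

Section WithinContinuity.
Context {X Y Z : topologicalType}.

Lemma within_comp (A : set X) (B : set Y) (f : X -> Y) (g : Y -> Z) :
  {within A, continuous f} -> {within B, continuous g} ->
  (forall x, A x -> B (f x)) -> {within A, continuous (g \o f)}.
Proof.
move=> /subspace_continuousP cf /subspace_continuousP cg fAB.
apply/subspace_continuousP => x Ax.
apply: cvg_trans (cg _ (fAB _ Ax)) => U /= gU.
have H : nbhs x [set y | A y -> B (f y) -> U (g (f y))] := cf x Ax _ gU.
suff : nbhs x [set y | A y -> U (g (f y))] by [].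
by apply: filterS H => y + Ay; apply => //; exact: fAB.
Qed.

Lemma within_comp_cont (A : set X) (B : set Y) (f : X -> Y) (g : Y -> Z) :
  continuous f -> {within B, continuous g} ->
  (forall x, A x -> B (f x)) -> {within A, continuous (g \o f)}.
Proof. by move=> cf; apply: within_comp; apply: continuous_subspaceT. Qed.

Lemma within_eq (A : set X) (f g : X -> Y) :
  (forall x, A x -> f x = g x) ->
  {within A, continuous f} -> {within A, continuous g}.
Proof.
move=> fg; apply: subspace_eq_continuous => x /set_mem; exact: fg.
Qed.

End WithinContinuity.

Section Gluing.
Context {R : realType}.

Lemma within_glue (T X : topologicalType) (D : set T) (c : T -> R) (m : R)
    (f g : T -> X) : continuous c ->
  {within [set x | D x /\ c x <= m], continuous f} ->
  {within [set x | D x /\ m <= c x], continuous g} ->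
  (forall x, D x -> c x = m -> f x = g x) ->
  {within D, continuous (fun x => if c x <= m then f x else g x)}.
Proof.
move=> cc /subspace_continuousP cf /subspace_continuousP cg fg.
apply/subspace_continuousP => x Dx U /= kU.
have Uf : nbhs x [set y | D y /\ c y <= m -> U (f y)].
  have [h|h] := leP (c x) m.
    by apply: (cf x (conj Dx h)); move: kU; rewrite /from_subspace h.
  have : nbhs x (c @^-1` [set r | m < r]).
    by apply: cc; apply: open_nbhs_nbhs; split => //; exact: open_gt.
  by apply: filterS => y /= my [_]; rewrite leNgt my.
have Ug : nbhs x [set y | D y /\ m <= c y -> U (g y)].
  have [h|h] := leP m (c x).
    apply: (cg x (conj Dx h)); move: kU; rewrite /from_subspace.
    by case: ifP => // h'; rewrite fg //; apply/eqP; rewrite eq_le h' h.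
  have : nbhs x (c @^-1` [set r | r < m]).
    by apply: cc; apply: open_nbhs_nbhs; split => //; exact: open_lt.
  by apply: filterS => y /= my [_]; rewrite leNgt my.
suff : nbhs x [set y | D y -> U (if c y <= m then f y else g y)] by [].
apply: filterS (filterI Uf Ug) => y /= [yf yg] Dy.
by case: (leP (c y) m) => h; [exact: yf|apply: yg; split=> //; exact: ltW].
Qed.

Lemma fst_cts (T U : topologicalType) : continuous (@fst T U).
Proof. by move=> p; exact: cvg_fst. Qed.

Lemma snd_cts (T U : topologicalType) : continuous (@snd T U).
Proof. by move=> p; exact: cvg_snd. Qed.

Lemma pair_cts (T U V : topologicalType) (f : T -> U) (g : T -> V) :
  continuous f -> continuous g -> continuous (fun x => (f x, g x)).
Proof. by move=> cf cg x; apply: cvg_pair; [exact: cf|exact: cg]. Qed.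

Lemma comp_cts (T U V : topologicalType) (f : T -> U) (g : U -> V) :
  continuous f -> continuous g -> continuous (fun x => g (f x)).
Proof. by move=> cf cg x; apply: continuous_comp; [exact: cf|exact: cg]. Qed.

Lemma add_cts (T : topologicalType) (f g : T -> R) :
  continuous f -> continuous g -> continuous (fun x => f x + g x).
Proof. by move=> cf cg x; apply: cvgD; [exact: cf|exact: cg]. Qed.

Lemma opp_cts (T : topologicalType) (f : T -> R) :
  continuous f -> continuous (fun x => - f x).
Proof. by move=> cf x; apply: cvgN; exact: cf. Qed.

Lemma mul_cts (T : topologicalType) (f g : T -> R) :
  continuous f -> continuous g -> continuous (fun x => f x * g x).
Proof. by move=> cf cg x; apply: cvgM; [exact: cf|exact: cg]. Qed.

Lemma cst_cts (T U : topologicalType) (c : U) : continuous (fun _ : T => c).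
Proof. by move=> x; exact: cvg_cst. Qed.

Lemma id_cts (T : topologicalType) : continuous (fun x : T => x).
Proof. by move=> x; exact: cvg_id. Qed.

Lemma abs_cts (T : topologicalType) (f : T -> R) :
  continuous f -> continuous (fun x => `|f x|).
Proof. by move=> cf x; apply: cvg_norm; exact: cf. Qed.

Lemma min_cts (T : topologicalType) (f g : T -> R) :
  continuous f -> continuous g -> continuous (fun x => Num.min (f x) (g x)).
Proof. by move=> cf cg x; apply: continuous_min; [exact: cf|exact: cg]. Qed.

Lemma max_cts (T : topologicalType) (f g : T -> R) :
  continuous f -> continuous g -> continuous (fun x => Num.max (f x) (g x)).
Proof. by move=> cf cg x; apply: continuous_max; [exact: cf|exact: cg]. Qed.

End Gluing.

Ltac cts := repeat (cbv beta; first [ assumption | lazymatch goal with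
  | |- continuous (fun x => x) => exact: id_cts
  | |- continuous (fun x => x.1) => exact: fst_cts
  | |- continuous (fun x => x.2) => exact: snd_cts
  | |- continuous (fun x => (@?f x, @?g x)) => apply: (@pair_cts _ _ _ f g)
  | |- continuous (fun x => @?f x + @?g x) => apply: (@add_cts _ _ f g)
  | |- continuous (fun x => @?f x * @?g x) => apply: (@mul_cts _ _ f g)
  | |- continuous (fun x => - @?f x) => apply: (@opp_cts _ _ f)
  | |- continuous (fun x => `|@?f x|) => apply: (@abs_cts _ _ f)
  | |- continuous (fun x => Num.min (@?f x) (@?g x)) =>
      apply: (@min_cts _ _ f g)
  | |- continuous (fun x => Num.max (@?f x) (@?g x)) =>
      apply: (@max_cts _ _ f g)
  | |- continuous ( *%R ?c) => apply: (@mul_cts _ _ (fun=> c) (fun x => x))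
  | |- continuous fst => exact: fst_cts
  | |- continuous snd => exact: snd_cts
  end
  | exact: id_cts | exact: fst_cts | exact: snd_cts | exact: cst_cts
  | apply: add_cts | apply: mul_cts | apply: opp_cts | apply: pair_cts ]).

Section UnitInterval.
Variable R : realType.

Definition I01 : set R := [set t | 0 <= t <= 1].
Definition square : set (R * R) := [set p | I01 p.1 /\ I01 p.2].

End UnitInterval.
Arguments I01 {R}.
Arguments square {R}.

Section FundamentalGroup.
Variables (R : realType) (X : topologicalType) (A : bset X).

Record loop := Loop {
  lfun :> R -> X;
  loop_cts : {within I01, continuous lfun};
  loop_in : forall t, I01 t -> carrier A (lfun t);
  loop0 : lfun 0 = base A;
  loop1 : lfun 1 = base A }.

HB.instance Definition _ := gen_eqMixin loop.
HB.instance Definition _ := gen_choiceMixin loop.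

Definition homotopic (f g : loop) : Prop := exists F : R * R -> X,
  [/\ {within square, continuous F},
      forall p, square p -> carrier A (F p),
      forall t, I01 t -> F (0, t) = f t,
      forall t, I01 t -> F (1, t) = g t &
      forall s, I01 s -> F (s, 0) = base A /\ F (s, 1) = base A].

Lemma I01_0 : I01 (0 : R). Proof. by rewrite /I01 /= lexx ler01. Qed.
Lemma I01_1 : I01 (1 : R). Proof. by rewrite /I01 /= lexx ler01. Qed.
Hint Resolve I01_0 I01_1 : core.

Lemma homotopic_reparam (p : R -> X) (phi psi : R -> R) (f g : loop) :
  {within I01, continuous p} -> (forall t, I01 t -> carrier A (p t)) ->
  continuous phi -> continuous psi ->
  (forall t, I01 t -> I01 (phi t)) -> (forall t, I01 t -> I01 (psi t)) ->
  phi 0 = psi 0 -> phi 1 = psi 1 ->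
  (forall t, I01 t -> f t = p (phi t)) ->
  (forall t, I01 t -> g t = p (psi t)) -> homotopic f g.
Proof.
move=> cp pA cphi cpsi phiI psiI e0 e1 fE gE.
pose h (q : R * R) := (1 - q.1) * phi q.2 + q.1 * psi q.2.
have hI q : square q -> I01 (h q).
  case: q => s t [/= /andP[s0 s1] tI].
  have /andP[a0 a1] := phiI _ tI; have /andP[b0 b1] := psiI _ tI.
  by rewrite /I01 /= /h /=; apply/andP; split; nra.
have hc : continuous h.
  have cphi2 : continuous (fun q : R * R => phi q.2).
    exact: comp_cts (@snd_cts R R) cphi.
  have cpsi2 : continuous (fun q : R * R => psi q.2).
    exact: comp_cts (@snd_cts R R) cpsi.
  by rewrite /h; cts.
exists (p \o h); split=> /=.
- exact: within_comp_cont hc cp hI.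
- by move=> q /hI; exact: pA.
- by move=> t tI; rewrite fE // /h /= subr0 mul1r mul0r addr0.
- by move=> t tI; rewrite gE // /h /= subrr mul1r mul0r add0r.
move=> s sI; rewrite /h /= -e0 -e1 -!mulrDl !subrK !mul1r.
by rewrite -!fE ?loop0 ?loop1.
Qed.

Lemma homotopic_eq (f g : loop) : (forall t, I01 t -> f t = g t) ->
  homotopic f g.
Proof.
move=> fg; apply: (@homotopic_reparam g id id f g) => //; try by cts.
- exact: loop_cts.
- exact: loop_in.
Qed.

Lemma homotopic_refl f : homotopic f f. Proof. exact: homotopic_eq. Qed.

Lemma homotopic_sym f g : homotopic f g -> homotopic g f.
Proof.
move=> [F [cF FA F0 F1 Fb]].
pose h (q : R * R) := (1 - q.1, q.2).
have hI q : square q -> square (h q).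
  by case: q => s t [/= /andP[s0 s1] tI]; split=> //=; rewrite /I01 /=; lra.
exists (F \o h); split=> /=.
- by apply: within_comp_cont cF hI; rewrite /h; cts.
- by move=> q /hI; exact: FA.
- by move=> t tI; rewrite /h /= subr0 F1.
- by move=> t tI; rewrite /h /= subrr F0.
by move=> s sI; apply: Fb; move: sI; rewrite /I01 /=; lra.
Qed.

Lemma homotopic_trans g f h : homotopic f g -> homotopic g h -> homotopic f h.
Proof.
move=> [F [cF FA F0 F1 Fb]] [G [cG GA G0 G1 Gb]].
pose u (q : R * R) := (2 * q.1, q.2); pose v (q : R * R) := (2 * q.1 - 1, q.2).
have uI q : square q /\ q.1 <= 2^-1 -> square (u q).
  by case: q => s t [[/= /andP[s0 s1] tI] h2]; split=> //; rewrite /I01 /=; lra.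
have vI q : square q /\ 2^-1 <= q.1 -> square (v q).
  by case: q => s t [[/= /andP[s0 s1] tI] h2]; split=> //; rewrite /I01 /=; lra.
exists (fun q => if q.1 <= 2^-1 then F (u q) else G (v q)); split=> /=.
- apply: within_glue.
  + exact: fst_cts.
  + by apply: within_comp_cont cF uI; rewrite /u; cts.
  + by apply: within_comp_cont cG vI; rewrite /v; cts.
  + move=> [s t] [/= _ tI] ->; rewrite /u /v /= mulfV ?pnatr_eq0 // subrr.
    by rewrite F1 // G0.
- move=> q qI; case: ifP => h2; first by apply/FA/uI.
  by apply/GA/vI; split=> //; apply/ltW; rewrite ltNge h2.
- by move=> t tI; rewrite invr_ge0 ler0n /u /= mulr0 F0.
- move=> t tI; case: ifP => h2; first by exfalso; lra.
  by rewrite /v /= (_ : 2 * 1 - 1 = 1) ?G1 //; lra.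
- move=> s; rewrite /I01 /= => /andP[s0 s1]; case: ifP => h2.
    by apply: Fb; rewrite /I01 /=; lra.
  by apply: Gb; rewrite /I01 /=; lra.
Qed.

Definition homotopy := PEquiv homotopic_refl homotopic_sym homotopic_trans.

Definition cat_fun (f g : R -> X) (t : R) : X :=
  if t <= 2^-1 then f (2 * t) else g (2 * t - 1).

Lemma cat_cts (f g : loop) : {within I01, continuous (cat_fun f g)}.
Proof.
apply: within_glue.
- exact: id_cts.
- apply: (within_comp_cont _ (@loop_cts f)); first by cts.
  by move=> t []; rewrite /I01 /=; lra.
- apply: (within_comp_cont _ (@loop_cts g)); first by cts.
  by move=> t []; rewrite /I01 /=; lra.
- by move=> t _ ->; rewrite mulfV ?pnatr_eq0 // subrr loop0 loop1.
Qed.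

Lemma cat_in (f g : loop) t : I01 t -> carrier A (cat_fun f g t).
Proof.
move=> tI; rewrite /cat_fun; case: ifP => h2; apply: loop_in;
by move: tI; rewrite /I01 /=; lra.
Qed.

Lemma cat0 (f g : loop) : cat_fun f g 0 = base A.
Proof. by rewrite /cat_fun invr_ge0 ler0n mulr0 loop0. Qed.

Lemma cat1 (f g : loop) : cat_fun f g 1 = base A.
Proof.
rewrite /cat_fun; case: ifP => h; first by exfalso; lra.
by rewrite (_ : 2 * 1 - 1 = 1) ?loop1 //; lra.
Qed.

Definition cat (f g : loop) : loop :=
  Loop (@cat_cts f g) (@cat_in f g) (cat0 f g) (cat1 f g).

Lemma cst_loop_cts : {within I01, continuous (fun _ : R => base A)}.
Proof. by apply: continuous_subspaceT; exact: cst_cts. Qed.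

Definition cst_loop : loop :=
  Loop cst_loop_cts (fun _ _ => base_in A) erefl erefl.

Section Reverse.
Variable f : loop.

Lemma rev_cts : {within I01, continuous (fun t => f (1 - t))}.
Proof.
apply: (within_comp_cont _ (@loop_cts f)); first by cts.
by move=> t; rewrite /I01 /=; lra.
Qed.

Lemma rev_in t : I01 t -> carrier A (f (1 - t)).
Proof. by move=> tI; apply: loop_in; move: tI; rewrite /I01 /=; lra. Qed.

Lemma rev0 : f (1 - 0) = base A. Proof. by rewrite subr0 loop1. Qed.
Lemma rev1 : f (1 - 1) = base A. Proof. by rewrite subrr loop0. Qed.

Definition rev_loop : loop := Loop rev_cts rev_in rev0 rev1.

End Reverse.

Lemma homotopic_cat f f' g g' : homotopic f f' -> homotopic g g' ->
  homotopic (cat f g) (cat f' g').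
Proof.
move=> [F [cF FA F0 F1 Fb]] [G [cG GA G0 G1 Gb]].
pose u (q : R * R) := (q.1, 2 * q.2); pose v (q : R * R) := (q.1, 2 * q.2 - 1).
have uI q : square q /\ q.2 <= 2^-1 -> square (u q).
  by case: q => s t [[/= sI /andP[t0 t1]] h2]; split=> //; rewrite /I01 /=; lra.
have vI q : square q /\ 2^-1 <= q.2 -> square (v q).
  by case: q => s t [[/= sI /andP[t0 t1]] h2]; split=> //; rewrite /I01 /=; lra.
exists (fun q => if q.2 <= 2^-1 then F (u q) else G (v q)); split=> /=.
- apply: within_glue.
  + exact: snd_cts.
  + by apply: within_comp_cont cF uI; rewrite /u; cts.
  + by apply: within_comp_cont cG vI; rewrite /v; cts.
  + move=> [s t] [/= sI _] ->; rewrite /u /v /= mulfV ?pnatr_eq0 // subrr.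
    by have [_ ->] := Fb s sI; have [-> _] := Gb s sI.
- move=> q qI; case: ifP => h2; first by apply/FA/uI.
  by apply/GA/vI; split=> //; apply/ltW; rewrite ltNge h2.
- move=> t; rewrite /I01 /= => /andP[t0 t1]; rewrite /cat_fun; case: ifP => h2.
    by rewrite /u F0 // /I01 /=; lra.
  by rewrite /v G0 // /I01 /=; lra.
- move=> t; rewrite /I01 /= => /andP[t0 t1]; rewrite /cat_fun; case: ifP => h2.
    by rewrite /u F1 // /I01 /=; lra.
  by rewrite /v G1 // /I01 /=; lra.
move=> s sI; rewrite invr_ge0 ler0n /u /v /= mulr0.
have [-> _] := Fb s sI; split=> //; case: ifP => h2; first by exfalso; lra.
by rewrite (_ : 2 * 1 - 1 = 1); [have [_ ->] := Gb s sI|lra].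
Qed.

Lemma homotopic_rev f g : homotopic f g -> homotopic (rev_loop f) (rev_loop g).
Proof.
move=> [F [cF FA F0 F1 Fb]]; pose u (q : R * R) := (q.1, 1 - q.2).
have uI q : square q -> square (u q).
  by case: q => s t [/= sI tI]; split=> //=; move: tI; rewrite /I01 /=; lra.
exists (F \o u); split=> /=.
- by apply: within_comp_cont cF uI; rewrite /u; cts.
- by move=> q /uI; exact: FA.
- by move=> t tI; rewrite /u F0 //; move: tI; rewrite /I01 /=; lra.
- by move=> t tI; rewrite /u F1 //; move: tI; rewrite /I01 /=; lra.
by move=> s sI; rewrite /u /= subr0 subrr; have [-> ->] := Fb s sI.
Qed.

Lemma homotopic_catA f g h :
  homotopic (cat f (cat g h)) (cat (cat f g) h).
Proof.
apply: homotopic_sym.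
apply: (@homotopic_reparam (cat f (cat g h))
  (fun t => Num.min (2 * t) (Num.min (t + 4^-1) (2^-1 * t + 2^-1))) id) => //.
- exact: loop_cts.
- exact: loop_in.
- by cts.
- by cts.
- by move=> t; rewrite /I01 /= !minEle => /andP[t0 t1]; do 2 case: ifP; lra.
- by rewrite !minEle; do 2 case: ifP; lra.
- by rewrite !minEle; do 2 case: ifP; lra.
move=> t; rewrite /I01 /= => /andP[t0 t1]; set phi := Num.min _ _.
have [h1|h1] := leP t 4^-1.
  have -> : phi = 2 * t by rewrite /phi; case: (leP (t + 4^-1)) => ?; case: leP => ?; lra.
  by rewrite /cat /= /cat_fun !ifT //; lra.
have [h2|h2] := leP t 2^-1.
  have -> : phi = t + 4^-1 by rewrite /phi; case: (leP (t + 4^-1)) => ?; case: leP => ?; lra.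
  rewrite /cat /= /cat_fun ifT // ifF; last by apply/negbTE; rewrite -ltNge; lra.
  rewrite ifF; last by apply/negbTE; rewrite -ltNge; lra.
  by rewrite ifT; [congr (g _)|]; lra.
have -> : phi = 2^-1 * t + 2^-1 by rewrite /phi; case: (leP (t + 4^-1)) => ?; case: leP => ?; lra.
rewrite /cat /= /cat_fun ifF; last by apply/negbTE; rewrite -ltNge; lra.
rewrite ifF; last by apply/negbTE; rewrite -ltNge; lra.
rewrite ifF; last by apply/negbTE; rewrite -ltNge; lra.
by congr (h _); lra.
Qed.

Lemma homotopic_cat1f f : homotopic (cat cst_loop f) f.
Proof.
apply: (@homotopic_reparam f (fun t => Num.max 0 (2 * t - 1)) id) => //.
- exact: loop_cts.
- exact: loop_in.
- by cts.
- by cts.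
- by move=> t; rewrite /I01 /= !maxEle => /andP[t0 t1]; case: ifP; lra.
- by rewrite !maxEle; case: ifP; lra.
- by rewrite !maxEle; case: ifP; lra.
move=> t; rewrite /I01 /= /cat_fun => /andP[t0 t1].
have [h|h] := leP t 2^-1.
  by rewrite (_ : Num.max _ _ = 0) ?loop0 //; case: leP => ?; lra.
by congr (f _); case: leP => ?; lra.
Qed.

Lemma homotopic_catf1 f : homotopic (cat f cst_loop) f.
Proof.
apply: (@homotopic_reparam f (fun t => Num.min (2 * t) 1) id) => //.
- exact: loop_cts.
- exact: loop_in.
- by cts.
- by cts.
- by move=> t; rewrite /I01 /= !minEle => /andP[t0 t1]; case: ifP; lra.
- by rewrite !minEle; case: ifP; lra.
- by rewrite !minEle; case: ifP; lra.
move=> t; rewrite /I01 /= /cat_fun => /andP[t0 t1].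
have [h|h] := leP t 2^-1; first by congr (f _); case: leP => ?; lra.
by rewrite (_ : Num.min _ _ = 1) ?loop1 //; case: leP => ?; lra.
Qed.

Lemma homotopic_catVf f : homotopic (cat (rev_loop f) f) cst_loop.
Proof.
apply: (@homotopic_reparam f (fun t => `|1 - 2 * t|) (fun=> 1)) => //.
- exact: loop_cts.
- exact: loop_in.
- by cts.
- by cts.
- by move=> t; rewrite /I01 /= => /andP[t0 t1]; case: ler0P; lra.
- by rewrite mulr0 subr0 normr1.
- by rewrite mulr1 ler0_norm; lra.
- move=> t; rewrite /I01 /= /cat_fun => /andP[t0 t1].
  by have [h|h] := leP t 2^-1; case: ler0P => h'; congr (f _); lra.
by move=> t _; rewrite loop1.
Qed.

Lemma homotopic_catfV f : homotopic (cat f (rev_loop f)) cst_loop.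
Proof.
apply: (@homotopic_reparam f (fun t => 1 - `|1 - 2 * t|) (fun=> 0)) => //.
- exact: loop_cts.
- exact: loop_in.
- by cts.
- by cts.
- by move=> t; rewrite /I01 /= => /andP[t0 t1]; case: ler0P; lra.
- by rewrite mulr0 subr0 normr1 subrr.
- by rewrite mulr1 ler0_norm; lra.
- move=> t; rewrite /I01 /= /cat_fun => /andP[t0 t1].
  by have [h|h] := leP t 2^-1; case: ler0P => h'; congr (f _); lra.
by move=> t _; rewrite loop0.
Qed.

Definition pi1 : Type := pquot homotopy.
HB.instance Definition _ := Choice.on pi1.

Definition hclass (f : loop) : pi1 := cls homotopy f.

Lemma pi1W (P : pi1 -> Prop) : (forall f, P (hclass f)) -> forall a, P a.
Proof. exact: pquotW. Qed.

Lemma hclassP f g : hclass f = hclass g <-> homotopic f g.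
Proof. exact: clsP. Qed.

Lemma hclass_rep a : hclass (rep a) = a.
Proof. exact: repK. Qed.

Definition pi1_one : pi1 := hclass cst_loop.
Definition pi1_inv (a : pi1) : pi1 := hclass (rev_loop (rep a)).
Definition pi1_mul (a b : pi1) : pi1 := hclass (cat (rep a) (rep b)).

Lemma pi1_mulE f g : pi1_mul (hclass f) (hclass g) = hclass (cat f g).
Proof. by apply/hclassP/homotopic_cat; apply/hclassP; exact: hclass_rep. Qed.

Lemma pi1_invE f : pi1_inv (hclass f) = hclass (rev_loop f).
Proof. by apply/hclassP/homotopic_rev; apply/hclassP; exact: hclass_rep. Qed.

Lemma pi1_mulA : associative pi1_mul.
Proof.
elim/pi1W=> f; elim/pi1W=> g; elim/pi1W=> h.
by rewrite !pi1_mulE; apply/hclassP; exact: homotopic_catA.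
Qed.

Lemma pi1_mul1 : left_id pi1_one pi1_mul.
Proof. by elim/pi1W=> f; rewrite pi1_mulE; apply/hclassP; exact: homotopic_cat1f. Qed.

Lemma pi1_mulr1 : right_id pi1_one pi1_mul.
Proof. by elim/pi1W=> f; rewrite pi1_mulE; apply/hclassP; exact: homotopic_catf1. Qed.

Lemma pi1_mulV : left_inverse pi1_one pi1_inv pi1_mul.
Proof.
elim/pi1W=> f; rewrite pi1_invE pi1_mulE; apply/hclassP; exact: homotopic_catVf.
Qed.

Lemma pi1_mulrV : right_inverse pi1_one pi1_inv pi1_mul.
Proof.
elim/pi1W=> f; rewrite pi1_invE pi1_mulE; apply/hclassP; exact: homotopic_catfV.
Qed.

HB.instance Definition _ :=
  isGroup.Build pi1 pi1_mulA pi1_mul1 pi1_mulr1 pi1_mulV pi1_mulrV.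

End FundamentalGroup.

Lemma within_pair (T U V : topologicalType) (D : set T) (f : T -> U)
    (g : T -> V) : {within D, continuous f} -> {within D, continuous g} ->
  {within D, continuous (fun x => (f x, g x))}.
Proof. by move=> cf cg x; apply: cvg_pair; [exact: cf|exact: cg]. Qed.

Section InducedMap.
Variables (R : realType) (X Y : topologicalType) (A : bset X) (B : bset Y).

Record bmap := BMap {
  bfun :> X -> Y;
  bmap_cts : {within carrier A, continuous bfun};
  bmap_in : forall x, carrier A x -> carrier B (bfun x);
  bmap_base : bfun (base A) = base B }.

Variable F : bmap.

Section Push.
Variable f : loop R A.

Lemma push_cts : {within I01, continuous (F \o f)}.
Proof. exact: within_comp (@loop_cts _ _ _ f) (@bmap_cts F) (@loop_in _ _ _ f). Qed.

Lemma push_in t : I01 t -> carrier B ((F \o f) t).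
Proof. by move=> tI; apply/bmap_in/loop_in. Qed.

Lemma push0 : (F \o f) 0 = base B. Proof. by rewrite /= loop0 bmap_base. Qed.
Lemma push1 : (F \o f) 1 = base B. Proof. by rewrite /= loop1 bmap_base. Qed.

Definition push : loop R B := Loop push_cts push_in push0 push1.

End Push.

Lemma homotopic_push f g : homotopic f g -> homotopic (push f) (push g).
Proof.
move=> [G [cG GA G0 G1 Gb]]; exists (F \o G); split=> /=.
- exact: within_comp cG (@bmap_cts F) GA.
- by move=> p /GA; exact: bmap_in.
- by move=> t tI; rewrite G0.
- by move=> t tI; rewrite G1.
by move=> s sI; have [-> ->] := Gb s sI; rewrite bmap_base.
Qed.

Definition pi1_map (a : pi1 R A) : pi1 R B := hclass (push (rep a)).

Lemma pi1_mapE f : pi1_map (hclass f) = hclass (push f).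
Proof. by apply/hclassP/homotopic_push/hclassP; exact: hclass_rep. Qed.

Lemma pi1_mapM : {morph pi1_map : a b / (a * b)%g}.
Proof.
elim/pi1W=> f; elim/pi1W=> g.
have mulE (Z : topologicalType) (C : bset Z) (p q : loop R C) :
  (hclass p * hclass q)%g = hclass (cat p q) := pi1_mulE p q.
rewrite mulE !pi1_mapE mulE; apply/hclassP.
by apply: homotopic_eq => t _; rewrite /= /cat_fun; case: ifP.
Qed.

Lemma pi1_map1 : pi1_map 1%g = 1%g.
Proof.
rewrite pi1_mapE; apply/hclassP/homotopic_eq => t _ /=; exact: bmap_base.
Qed.

HB.instance Definition _ :=
  isUMagmaMorphism.Build (pi1 R A) (pi1 R B) pi1_map (pi1_map1, pi1_mapM).

End InducedMap.

Record bordered (X : topologicalType) := Bordered {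
  surface :> bset X;
  bdry : set X;
  bdry_sub : bdry `<=` carrier surface;
  base_bdry : bdry (base surface) }.

Section MappingClassGroup.
Variables (R : realType) (X : topologicalType) (S : bordered X).

Local Notation cS := (carrier (surface S)).

(* No orientation condition is needed: a homeomorphism of a connected oriented
   surface that fixes a nonempty boundary pointwise preserves orientation *)
Record homeo := Homeo {
  hfun :> X -> X;
  hinv : X -> X;
  hfun_cts : {within cS, continuous hfun};
  hinv_cts : {within cS, continuous hinv};
  hfun_in : forall x, cS x -> cS (hfun x);
  hinv_in : forall x, cS x -> cS (hinv x);
  hfunK : forall x, cS x -> hinv (hfun x) = x;
  hinvK : forall x, cS x -> hfun (hinv x) = x;
  hfun_bdry : forall x, bdry S x -> hfun x = x }.

HB.instance Definition _ := gen_eqMixin homeo.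
HB.instance Definition _ := gen_choiceMixin homeo.

Definition isotopic (f g : homeo) : Prop := exists F : R * X -> X,
  [/\ {within I01 `*` cS, continuous F},
      forall s, I01 s -> exists h : homeo, forall x, cS x -> F (s, x) = h x,
      forall x, cS x -> F (0, x) = f x &
      forall x, cS x -> F (1, x) = g x].

Lemma isotopic_in (F : R * X -> X) :
  (forall s, I01 s -> exists h : homeo, forall x, cS x -> F (s, x) = h x) ->
  forall p, (I01 `*` cS) p -> cS (F p).
Proof.
move=> Fh [s x] [/= sI Sx]; have [h hE] := Fh s sI.
by rewrite hE //; exact: hfun_in.
Qed.

Lemma isotopic_eq (f g : homeo) : (forall x, cS x -> f x = g x) ->
  isotopic f g.
Proof.
move=> fg; exists (f \o snd); split=> //=; last by move=> s _; exists f.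
by apply: (within_comp_cont _ (@hfun_cts f)); [exact: snd_cts|case=> ? ? []].
Qed.

Lemma isotopic_refl f : isotopic f f. Proof. exact: isotopic_eq. Qed.

Lemma isotopic_sym f g : isotopic f g -> isotopic g f.
Proof.
move=> [F [cF Fh F0 F1]].
exists (F \o (fun q => (1 - q.1, q.2))); split=> /=.
- apply: (within_comp_cont _ cF); first by apply: pair_cts; cts.
  by case=> s x [/= sI Sx]; split=> //=; move: sI; rewrite /I01 /=; lra.
- by move=> s sI; apply: Fh; move: sI; rewrite /I01 /=; lra.
- by move=> x Sx; rewrite subr0 F1.
by move=> x Sx; rewrite subrr F0.
Qed.

Lemma isotopic_trans g f h : isotopic f g -> isotopic g h -> isotopic f h.
Proof.
move=> [F [cF Fh F0 F1]] [G [cG Gh G0 G1]].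
pose u (q : R * X) := (2 * q.1, q.2); pose v (q : R * X) := (2 * q.1 - 1, q.2).
exists (fun q => if q.1 <= 2^-1 then F (u q) else G (v q)); split=> /=.
- apply: within_glue.
  + exact: fst_cts.
  + apply: (within_comp_cont _ cF); first by rewrite /u; cts.
    by case=> s x [[/= sI Sx] h2]; split=> //=; move: sI; rewrite /I01 /=; lra.
  + apply: (within_comp_cont _ cG); first by rewrite /v; cts.
    by case=> s x [[/= sI Sx] h2]; split=> //=; move: sI; rewrite /I01 /=; lra.
  + move=> [s t] [/= _ tI] ->; rewrite /u /v /= mulfV ?pnatr_eq0 // subrr.
    by rewrite F1 // G0.
- move=> s /andP[s0 s1]; have [h2|h2] := leP s 2^-1.
    by apply: (Fh (2 * s)); rewrite /I01 /=; lra.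
  by apply: (Gh (2 * s - 1)); rewrite /I01 /=; lra.
- by move=> x Sx; rewrite invr_ge0 ler0n /u /= mulr0 F0.
move=> x Sx; case: ifP => h2; first by exfalso; lra.
by rewrite /v /= (_ : 2 * 1 - 1 = 1 :> R) ?G1 //; lra.
Qed.

Definition isotopy := PEquiv isotopic_refl isotopic_sym isotopic_trans.

Section Composition.
Variables f g : homeo.

Lemma comp_hcts : {within cS, continuous (f \o g)}.
Proof.
exact: within_comp (@hfun_cts g) (@hfun_cts f) (@hfun_in g).
Qed.

Lemma comp_hinv_cts : {within cS, continuous (hinv g \o hinv f)}.
Proof.
exact: within_comp (@hinv_cts f) (@hinv_cts g) (@hinv_in f).
Qed.

Lemma comp_hin x : cS x -> cS ((f \o g) x).
Proof. by move=> Sx; do 2 apply: hfun_in. Qed.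

Lemma comp_hinv_in x : cS x -> cS ((hinv g \o hinv f) x).
Proof. by move=> Sx; do 2 apply: hinv_in. Qed.

Lemma comp_hK x : cS x -> (hinv g \o hinv f) ((f \o g) x) = x.
Proof. by move=> Sx /=; rewrite !hfunK //; exact: hfun_in. Qed.

Lemma comp_hinvK x : cS x -> (f \o g) ((hinv g \o hinv f) x) = x.
Proof. by move=> Sx /=; rewrite !hinvK //; exact: hinv_in. Qed.

Lemma comp_bdry x : bdry S x -> (f \o g) x = x.
Proof. by move=> Sx /=; rewrite !hfun_bdry. Qed.

Definition hcomp : homeo := Homeo comp_hcts comp_hinv_cts comp_hin comp_hinv_in
  comp_hK comp_hinvK comp_bdry.

Lemma inv_bdry x : bdry S x -> hinv f x = x.
Proof.
move=> Sx; rewrite -{1}(hfun_bdry f Sx) hfunK //; exact: bdry_sub.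
Qed.

Definition hrev : homeo := Homeo (@hinv_cts f) (@hfun_cts f) (@hinv_in f)
  (@hfun_in f) (@hinvK f) (@hfunK f) inv_bdry.

Definition hid : homeo := Homeo (continuous_subspaceT (@id_cts X))
  (continuous_subspaceT (@id_cts X)) (fun _ => id) (fun _ => id)
  (fun _ _ => erefl) (fun _ _ => erefl) (fun _ _ => erefl).

End Composition.

Lemma isotopic_comp f f' g g' : isotopic f f' -> isotopic g g' ->
  isotopic (hcomp f g) (hcomp f' g').
Proof.
move=> [F [cF Fh F0 F1]] [G [cG Gh G0 G1]].
exists (fun q => F (q.1, G q)); split=> /=.
- apply: within_comp cF _; last first.
    by case=> s x [/= sI Sx]; split=> //; apply: (isotopic_in Gh).
  by apply: within_pair cG; apply: continuous_subspaceT; exact: fst_cts.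
- move=> s sI; have [h hE] := Fh s sI; have [k kE] := Gh s sI.
  by exists (hcomp h k) => x Sx; rewrite kE // hE //; exact: hfun_in.
- by move=> x Sx; rewrite G0 // F0 //; exact: hfun_in.
by move=> x Sx; rewrite G1 // F1 //; exact: hfun_in.
Qed.

Lemma isotopic_rev f g : isotopic f g -> isotopic (hrev f) (hrev g).
Proof.
move=> fg; apply: isotopic_sym.
have : isotopic (hcomp (hrev f) (hcomp f (hrev g)))
                (hcomp (hrev f) (hcomp g (hrev g))).
  apply: isotopic_comp; first exact: isotopic_refl.
  by apply: isotopic_comp => //; exact: isotopic_refl.
have e1 : isotopic (hrev g) (hcomp (hrev f) (hcomp f (hrev g))).
  by apply: isotopic_eq => x Sx /=; rewrite hfunK //; exact: hinv_in.
have e2 : isotopic (hcomp (hrev f) (hcomp g (hrev g))) (hrev f).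
  by apply: isotopic_eq => x Sx /=; rewrite hinvK.
by move=> e; apply: isotopic_trans e1 (isotopic_trans e e2).
Qed.

Definition mcg : Type := pquot isotopy.
HB.instance Definition _ := Choice.on mcg.

Definition iclass (f : homeo) : mcg := cls isotopy f.

Lemma mcgW (P : mcg -> Prop) : (forall f, P (iclass f)) -> forall a, P a.
Proof. exact: pquotW. Qed.

Lemma iclassP f g : iclass f = iclass g <-> isotopic f g.
Proof. exact: clsP. Qed.

Lemma iclass_rep a : iclass (rep a) = a.
Proof. exact: repK. Qed.

Definition mcg_one : mcg := iclass hid.
Definition mcg_inv (a : mcg) : mcg := iclass (hrev (rep a)).
Definition mcg_mul (a b : mcg) : mcg := iclass (hcomp (rep a) (rep b)).

Lemma mcg_mulE f g : mcg_mul (iclass f) (iclass g) = iclass (hcomp f g).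
Proof. by apply/iclassP/isotopic_comp; apply/iclassP; exact: iclass_rep. Qed.

Lemma mcg_invE f : mcg_inv (iclass f) = iclass (hrev f).
Proof. by apply/iclassP/isotopic_rev; apply/iclassP; exact: iclass_rep. Qed.

Lemma mcg_mulA : associative mcg_mul.
Proof.
elim/mcgW=> f; elim/mcgW=> g; elim/mcgW=> h; rewrite !mcg_mulE.
by apply/iclassP; exact: isotopic_eq.
Qed.

Lemma mcg_mul1 : left_id mcg_one mcg_mul.
Proof.
by elim/mcgW=> f; rewrite mcg_mulE; apply/iclassP; exact: isotopic_eq.
Qed.

Lemma mcg_mulr1 : right_id mcg_one mcg_mul.
Proof.
by elim/mcgW=> f; rewrite mcg_mulE; apply/iclassP; exact: isotopic_eq.
Qed.

Lemma mcg_mulV : left_inverse mcg_one mcg_inv mcg_mul.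
Proof.
elim/mcgW=> f; rewrite mcg_invE mcg_mulE; apply/iclassP.
by apply: isotopic_eq => x Sx /=; exact: hfunK.
Qed.

Lemma mcg_mulrV : right_inverse mcg_one mcg_inv mcg_mul.
Proof.
elim/mcgW=> f; rewrite mcg_invE mcg_mulE; apply/iclassP.
by apply: isotopic_eq => x Sx /=; exact: hinvK.
Qed.

HB.instance Definition _ :=
  isGroup.Build mcg mcg_mulA mcg_mul1 mcg_mulr1 mcg_mulV mcg_mulrV.

Definition homeo_bmap (f : homeo) : bmap S S :=
  BMap (@hfun_cts f) (@hfun_in f) (hfun_bdry f (@base_bdry _ S)).

Definition mcg_act (h : mcg) (k : pi1 R S) : pi1 R S :=
  pi1_map (homeo_bmap (rep h)) k.

Lemma mcg_actE f k : mcg_act (iclass f) k = pi1_map (homeo_bmap f) k.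
Proof.
have /iclassP : iclass (rep (iclass f)) = iclass f by exact: iclass_rep.
rewrite /mcg_act; move: (rep _) => g [F [cF Fh F0 F1]].
move: k; elim/pi1W=> p; rewrite !pi1_mapE; apply/hclassP.
have pc : {within square, continuous (fun q : R * R => (q.1, p q.2))}.
  apply: within_pair; first by apply: continuous_subspaceT; exact: fst_cts.
  apply: (within_comp_cont _ (@loop_cts _ _ _ p)); first exact: snd_cts.
  by move=> ? [].
have pI q : square q -> (I01 `*` cS) (q.1, p q.2).
  by case: q => s t [/= sI tI]; split=> //=; exact: loop_in.
exists (F \o (fun q : R * R => (q.1, p q.2))); split=> /=.
- exact: within_comp pc cF pI.
- by move=> q /pI; exact: isotopic_in.
- by move=> t tI; rewrite F0 //; exact: loop_in.
- by move=> t tI; rewrite F1 //; exact: loop_in.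
move=> s sI; rewrite loop0 loop1; have [h hE] := Fh s sI.
by rewrite hE ?hfun_bdry //; [exact: base_bdry|exact: base_in].
Qed.

End MappingClassGroup.

Section Subgroups.
Variable G : groupType.
Implicit Types (A B : set G) (a b : G).

Definition gcomm a b : G := (a * b * a^-1 * b^-1)%g.

Definition is_subgroup A : Prop :=
  A 1%g /\ forall a b, A a -> A b -> A (a * b^-1)%g.

Definition is_normal_subgroup A : Prop :=
  is_subgroup A /\ forall a b, A a -> A (b * a * b^-1)%g.

Definition generated A : set G := smallest is_subgroup A.
Definition normal_closure A : set G := smallest is_normal_subgroup A.

Definition commutator_subgroup A B : set G :=
  generated [set gcomm a b | a in A & b in B].

Definition set_prod A B : set G := [set (a * b)%g | a in A & b in B].

(* [Gamma A k] is the k-th term of the lower central series, for [1 <= k];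
   [Gamma A 0] is a dummy value *)
Fixpoint Gamma A (k : nat) : set G :=
  match k with
  | 0 | 1 => A
  | k'.+1 => commutator_subgroup A (Gamma A k')
  end.

Fixpoint dlcs A B (m : nat) {struct m} : nat -> set G :=
  match m with
  | 0 => fun n => if n is 0 then setT else Gamma B n
  | m'.+1 => fix dlcs_m (n : nat) : set G :=
      match n with
      | 0 => Gamma A m'.+1
      | n'.+1 => set_prod
          (commutator_subgroup A (dlcs A B m' n'.+1))
          (commutator_subgroup B (dlcs_m n'))
      end
  end.

Lemma dlcsS A B m n : dlcs A B m.+1 n.+1 = set_prod
  (commutator_subgroup (dlcs A B 1 0) (dlcs A B m n.+1))
  (commutator_subgroup (dlcs A B 0 1) (dlcs A B m.+1 n)).
Proof. by []. Qed.

Definition nat_of_int (m : int) : nat := if m is Posz m' then m' else 0%N.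

(* K_{m,n} = K_{max(0,m),max(0,n)} for integers m, n *)
Definition dlcsz A B (m n : int) : set G :=
  dlcs A B (nat_of_int m) (nat_of_int n).

Definition dlcs_gt A B (m n : nat) : set G :=
  set_prod (dlcs A B m.+1 n) (dlcs A B m n.+1).

Definition free_basis (I : Type) (e : I -> G) : Prop :=
  forall (G' : groupType) (f : I -> G'),
    exists! phi : G -> G', {morph phi : a b / (a * b)%g} /\ phi \o e = f.

Lemma gen_subgroup A : is_subgroup (generated A).
Proof.
split=> [B [[B1 _] _] //|a b ga gb B BA]; case: (BA) => -[_ BM] _.
exact: BM (ga B BA) (gb B BA).
Qed.

End Subgroups.

Arguments dlcs {G} A B m n : simpl never.

Section Abelianization.
Variable G : groupType.
Implicit Types a b c : G.

Let DG : set G := commutator_subgroup setT setT.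
Definition ab_eq a b : Prop := DG (a * b^-1)%g.

Let DG1 : DG 1%g. Proof. exact: (gen_subgroup _).1. Qed.
Let DGF a b : DG a -> DG b -> DG (a * b^-1)%g.
Proof. exact: (gen_subgroup _).2. Qed.
Let DGV a : DG a -> DG a^-1%g.
Proof. by move=> /(DGF DG1); rewrite mul1g. Qed.
Let DGM a b : DG a -> DG b -> DG (a * b)%g.
Proof. by move=> Da /DGV /(DGF Da); rewrite invgK. Qed.
Let DGc a b : DG (gcomm a b).
Proof. by apply: sub_gen_smallest; exists a => //; exists b. Qed.
Let DGJ a b : DG a -> DG (b * a * b^-1)%g.
Proof.
move=> Da; rewrite (_ : (b * a * b^-1)%g = (gcomm b a * a)%g); first exact: DGM.
by rewrite /gcomm -!mulgA mulVg mulg1.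
Qed.

Lemma ab_refl a : ab_eq a a. Proof. by rewrite /ab_eq mulgV. Qed.
Lemma ab_sym a b : ab_eq a b -> ab_eq b a.
Proof. by move=> /DGV; rewrite /ab_eq invgM invgK. Qed.
Lemma ab_trans b a c : ab_eq a b -> ab_eq b c -> ab_eq a c.
Proof.
by move=> h k; have := DGM h k; rewrite /ab_eq -mulgA mulKg.
Qed.

Definition ab_equiv := PEquiv ab_refl ab_sym ab_trans.

Definition abelianization : Type := pquot ab_equiv.
HB.instance Definition _ := Choice.on abelianization.

Definition abclass a : abelianization := cls ab_equiv a.

Lemma abW (P : abelianization -> Prop) :
  (forall a, P (abclass a)) -> forall u, P u.
Proof. exact: pquotW. Qed.

Lemma abP a b : abclass a = abclass b <-> ab_eq a b.
Proof. exact: clsP. Qed.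

Lemma abclass_rep u : abclass (rep u) = u. Proof. exact: repK. Qed.

Lemma ab_rep a : ab_eq (rep (abclass a)) a.
Proof. exact: (rep_cls ab_equiv). Qed.

Definition ab_add (u v : abelianization) := abclass (rep u * rep v)%g.
Definition ab_opp (u : abelianization) := abclass (rep u)^-1%g.

Lemma ab_eqM a a' b b' : ab_eq a a' -> ab_eq b b' -> ab_eq (a * b)%g (a' * b')%g.
Proof.
move=> h k; rewrite /ab_eq invgM !mulgA.
rewrite (_ : (a * b * b'^-1 * a'^-1)%g =
  ((a * (b * b'^-1) * a^-1) * (a * a'^-1))%g); first exact: DGM (DGJ _ k) h.
by rewrite -!mulgA mulKg.
Qed.

Lemma ab_eqV a a' : ab_eq a a' -> ab_eq a^-1%g a'^-1%g.
Proof.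
move=> /ab_sym h; rewrite /ab_eq invgK.
rewrite (_ : (a^-1 * a')%g = (a^-1 * (a' * a^-1) * a^-1^-1)%g).
  exact: DGJ.
by rewrite invgK -!mulgA mulVg mulg1.
Qed.

Lemma ab_addE a b : ab_add (abclass a) (abclass b) = abclass (a * b)%g.
Proof. by apply/abP; apply: ab_eqM; exact: ab_rep. Qed.

Lemma ab_oppE a : ab_opp (abclass a) = abclass a^-1%g.
Proof. by apply/abP; apply: ab_eqV; exact: ab_rep. Qed.

Lemma ab_addA : associative ab_add.
Proof. by elim/abW=> a; elim/abW=> b; elim/abW=> c; rewrite !ab_addE mulgA. Qed.

Lemma ab_addC : commutative ab_add.
Proof.
elim/abW=> a; elim/abW=> b; rewrite !ab_addE; apply/abP.
by rewrite /ab_eq invgM mulgA; exact: DGc.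
Qed.

Lemma ab_add0 : left_id (abclass 1%g) ab_add.
Proof. by elim/abW=> a; rewrite ab_addE mul1g. Qed.

Lemma ab_addN : left_inverse (abclass 1%g) ab_opp ab_add.
Proof. by elim/abW=> a; rewrite ab_oppE ab_addE mulVg. Qed.

HB.instance Definition _ :=
  GRing.isZmodule.Build abelianization ab_addA ab_addC ab_add0 ab_addN.

Lemma abclassM a b : abclass (a * b)%g = abclass a + abclass b.
Proof. exact/esym/ab_addE. Qed.

End Abelianization.

Section AbelianizationMap.
Variables (G G' : groupType) (f : UMagmaMorphism.type G G').

Definition abmap (u : abelianization G) : abelianization G' :=
  abclass (f (rep u)).

Lemma abmapE a : abmap (abclass a) = abclass (f a).
Proof.
have := ab_rep a.
rewrite /abmap; move: (rep _) => b ba; apply/abP.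
suff : commutator_subgroup setT setT `<=`
  [set c | commutator_subgroup setT setT (f c)].
  by move=> /(_ _ ba) /=; rewrite gmulfF.
have [S1 SF] := gen_subgroup [set gcomm a b | a in @setT G' & b in @setT G'].
apply: smallest_sub => /=.
  split=> /=; first by rewrite gmulf1.
  by move=> c d; rewrite gmulfF; exact: SF.
move=> _ [c _ [d _ <-]]; apply: sub_gen_smallest.
by exists (f c) => //; exists (f d) => //; rewrite /gcomm !gmulfM !gmulfV.
Qed.

Lemma abmapB : {morph abmap : u v / u - v}.
Proof.
elim/abW=> a; elim/abW=> b.
rewrite (_ : abclass a - abclass b = abclass (a / b)%g); last first.
  by apply/eqP; rewrite subr_eq -abclassM mulgVK.
rewrite !abmapE gmulfF; apply/eqP.
by rewrite eq_sym subr_eq -abclassM mulgVK.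
Qed.

HB.instance Definition _ :=
  GRing.isZmodMorphism.Build (abelianization G) (abelianization G') abmap abmapB.

End AbelianizationMap.

Section Kernel.
Variables (U V : zmodType) (f : {additive U -> V}).

Definition ker_pred : {pred U} := fun u => f u == 0.

Lemma ker_zmod_closed : zmod_closed ker_pred.
Proof.
split=> [|u v]; rewrite /ker_pred unfold_in ?raddf0 //.
by move=> /eqP fu /eqP fv; rewrite unfold_in /= raddfB fu fv subr0.
Qed.
HB.instance Definition _ := GRing.isZmodClosed.Build U ker_pred ker_zmod_closed.

Definition kernel : Type := {u : U | u \in ker_pred}.
HB.instance Definition _ := Choice.on kernel.
HB.instance Definition _ := SubChoice.on kernel.
HB.instance Definition _ := [SubChoice_isSubZmodule of kernel by <:].

End Kernel.

Section FreeLie.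
Variable C : zmodType.

Inductive lterm : Type :=
  | LGen of C
  | LZero
  | LOpp of lterm
  | LAdd of lterm & lterm
  | LBr of lterm & lterm.

HB.instance Definition _ := gen_eqMixin lterm.
HB.instance Definition _ := gen_choiceMixin lterm.

Inductive lie_eq : lterm -> lterm -> Prop :=
  | lie_refl u : lie_eq u u
  | lie_sym u v : lie_eq u v -> lie_eq v u
  | lie_trans v u w : lie_eq u v -> lie_eq v w -> lie_eq u w
  | lie_congN u u' : lie_eq u u' -> lie_eq (LOpp u) (LOpp u')
  | lie_congD u u' v v' : lie_eq u u' -> lie_eq v v' ->
      lie_eq (LAdd u v) (LAdd u' v')
  | lie_congB u u' v v' : lie_eq u u' -> lie_eq v v' ->
      lie_eq (LBr u v) (LBr u' v')
  | lie_addA u v w : lie_eq (LAdd u (LAdd v w)) (LAdd (LAdd u v) w)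
  | lie_addC u v : lie_eq (LAdd u v) (LAdd v u)
  | lie_add0 u : lie_eq (LAdd LZero u) u
  | lie_addN u : lie_eq (LAdd (LOpp u) u) LZero
  | lie_genD c d : lie_eq (LGen (c + d)) (LAdd (LGen c) (LGen d))
  | lie_brDl u v w : lie_eq (LBr (LAdd u v) w) (LAdd (LBr u w) (LBr v w))
  | lie_brDr u v w : lie_eq (LBr u (LAdd v w)) (LAdd (LBr u v) (LBr u w))
  | lie_alt u : lie_eq (LBr u u) LZero
  | lie_jacobi u v w : lie_eq
      (LAdd (LBr u (LBr v w)) (LAdd (LBr v (LBr w u)) (LBr w (LBr u v)))) LZero.

Definition lie_equiv := PEquiv lie_refl lie_sym lie_trans.

Definition free_lie : Type := pquot lie_equiv.
HB.instance Definition _ := Choice.on free_lie.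

Let q : lterm -> free_lie := cls lie_equiv.
Let qP u v : q u = q v <-> lie_eq u v. Proof. exact: clsP. Qed.
Let qW (P : free_lie -> Prop) : (forall u, P (q u)) -> forall u, P u.
Proof. exact: pquotW. Qed.
Let qrep u : lie_eq (rep (q u)) u. Proof. exact: (rep_cls lie_equiv). Qed.

Definition lie_gen (c : C) : free_lie := q (LGen c).
Definition lie_zero : free_lie := q LZero.
Definition lie_opp (u : free_lie) : free_lie := q (LOpp (rep u)).
Definition lie_add (u v : free_lie) : free_lie := q (LAdd (rep u) (rep v)).
Definition lie_br (u v : free_lie) : free_lie := q (LBr (rep u) (rep v)).

Let oppE u : lie_opp (q u) = q (LOpp u).
Proof. by apply/qP/lie_congN/qrep. Qed.
Let addE u v : lie_add (q u) (q v) = q (LAdd u v).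
Proof. by apply/qP/lie_congD; exact/qrep. Qed.
Let brE u v : lie_br (q u) (q v) = q (LBr u v).
Proof. by apply/qP/lie_congB; exact/qrep. Qed.

Fact lie_ringA : associative lie_add.
Proof.
by elim/qW=> u; elim/qW=> v; elim/qW=> w; rewrite !addE; apply/qP/lie_addA.
Qed.
Fact lie_ringC : commutative lie_add.
Proof. by elim/qW=> u; elim/qW=> v; rewrite !addE; apply/qP/lie_addC. Qed.
Fact lie_ring0 : left_id lie_zero lie_add.
Proof. by elim/qW=> u; rewrite !addE; apply/qP/lie_add0. Qed.
Fact lie_ringN : left_inverse lie_zero lie_opp lie_add.
Proof. by elim/qW=> u; rewrite oppE !addE; apply/qP/lie_addN. Qed.

HB.instance Definition _ :=
  GRing.isZmodule.Build free_lie lie_ringA lie_ringC lie_ring0 lie_ringN.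

Let qD u v : q u + q v = q (LAdd u v). Proof. exact: addE. Qed.

Lemma lie_gD c d : lie_gen (c + d) = lie_gen c + lie_gen d.
Proof. by rewrite [RHS]qD; apply/qP/lie_genD. Qed.

Lemma lie_brD u : {morph lie_br u : v w / v + w}.
Proof.
elim/qW: u => u; elim/qW=> v; elim/qW=> w.
by rewrite /= qD !brE qD; apply/qP/lie_brDr.
Qed.

Lemma lie_Dbr w : {morph lie_br^~ w : u v / u + v}.
Proof.
elim/qW: w => w; elim/qW=> u; elim/qW=> v.
by rewrite /= qD !brE qD; apply/qP/lie_brDl.
Qed.

Lemma lie_bruu u : lie_br u u = 0.
Proof. by elim/qW: u => u; rewrite brE; apply/qP/lie_alt. Qed.

Lemma lie_brJ u v w :
  lie_br u (lie_br v w) + (lie_br v (lie_br w u) + lie_br w (lie_br u v)) = 0.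
Proof.
elim/qW: u => u; elim/qW: v => v; elim/qW: w => w; rewrite !brE.
by rewrite !qD; apply/qP/lie_jacobi.
Qed.

(* Homogeneous components for a grading of the generators: [gr i c] means that
   the generator [c] has degree [i] *)
Inductive lie_homog (I : nmodType) (gr : I -> C -> Prop) :
    I -> free_lie -> Prop :=
  | homog_gen i c : gr i c -> lie_homog gr i (lie_gen c)
  | homog0 i : lie_homog gr i 0
  | homogB i u v : lie_homog gr i u -> lie_homog gr i v ->
      lie_homog gr i (u - v)
  | homog_br i j u v : lie_homog gr i u -> lie_homog gr j v ->
      lie_homog gr (i + j) (lie_br u v).

End FreeLie.

Section LieMap.
Variables (C C' : zmodType) (f : C -> C').

Fixpoint lie_eval (u : lterm C) : free_lie C' :=
  match u with
  | LGen c => lie_gen (f c)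
  | LZero => 0
  | LOpp u => - lie_eval u
  | LAdd u v => lie_eval u + lie_eval v
  | LBr u v => lie_br (lie_eval u) (lie_eval v)
  end.

(* For additive [f], the induced homomorphism of Lie rings *)
Definition lie_map (u : free_lie C) : free_lie C' := lie_eval (rep u).

End LieMap.

Section LieMapTheory.
Variables (C C' : zmodType) (f : {additive C -> C'}).

Lemma lie_eval_eq u v : lie_eq u v -> lie_eval f u = lie_eval f v.
Proof.
elim=> //=.
- by move=> ? ? ? _ -> _ ->.
- by move=> ? ? _ ->.
- by move=> ? ? ? ? _ -> _ ->.
- by move=> ? ? ? ? _ -> _ ->.
- by move=> *; rewrite addrA.
- by move=> *; rewrite addrC.
- by move=> *; rewrite add0r.
- by move=> *; rewrite addNr.
- by move=> *; rewrite raddfD lie_gD.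
- by move=> *; rewrite lie_Dbr.
- by move=> *; rewrite lie_brD.
- by move=> *; rewrite lie_bruu.
- by move=> *; rewrite lie_brJ.
Qed.

Let lmE u : lie_map f (cls (lie_equiv C) u) = lie_eval f u.
Proof. by apply/lie_eval_eq/(rep_cls (lie_equiv C)). Qed.

Lemma lie_map_gen c : lie_map f (lie_gen c) = lie_gen (f c).
Proof. exact: lmE. Qed.

Lemma lie_map_br u v :
  lie_map f (lie_br u v) = lie_br (lie_map f u) (lie_map f v).
Proof. exact: lmE. Qed.

Lemma lie_mapB : {morph lie_map f : u v / u - v}.
Proof.
move=> u v; rewrite [LHS]lmE /=; congr (_ + _).
rewrite -[LHS]/(lie_eval f (rep (- v))); exact: lmE.
Qed.

HB.instance Definition _ :=
  GRing.isZmodMorphism.Build (free_lie C) (free_lie C') (lie_map f) lie_mapB.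

End LieMapTheory.

Section LieComponent.
Variables (C : zmodType) (I : nmodType) (gr : I -> C -> Prop) (i : I).

Definition lie_comp_pred : {pred free_lie C} := fun u => `[< lie_homog gr i u >].

Lemma lie_comp_zmod_closed : zmod_closed lie_comp_pred.
Proof.
split=> [|u v]; first by apply/asboolP; exact: homog0.
by move=> /asboolP hu /asboolP hv; apply/asboolP; exact: homogB.
Qed.
HB.instance Definition _ :=
  GRing.isZmodClosed.Build (free_lie C) lie_comp_pred lie_comp_zmod_closed.

Definition lie_comp : Type := {u : free_lie C | u \in lie_comp_pred}.
HB.instance Definition _ := Choice.on lie_comp.
HB.instance Definition _ := SubChoice.on lie_comp.
HB.instance Definition _ := [SubChoice_isSubZmodule of lie_comp by <:].

End LieComponent.

Definition lie_deg (C : zmodType) : nat -> zmodType :=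
  lie_comp (fun (i : nat) (c : C) => i = 1%N).

(* The map Lie_m(C) -> Lie_k(C') induced by [f : C -> C'], for k = m *)
Definition lie_deg_map (C C' : zmodType) (f : C -> C') (m k : nat)
    (u : lie_deg C m) : lie_deg C' k := insubd 0 (lie_map f (val u)).
Arguments lie_deg_map {C C'} f m k u.

Lemma lie_deg_mapE (C C' : zmodType) (f : {additive C -> C'}) m
    (u : lie_deg C m) : val (lie_deg_map f m m u) = lie_map f (val u).
Proof.
rewrite /lie_deg_map val_insubd ifT //; apply/asboolP.
case: u => u /= /asboolP; elim=> {u}.
- by move=> i c ->; rewrite lie_map_gen; exact: homog_gen.
- by move=> i; rewrite raddf0; exact: homog0.
- by move=> i u v _ hu _ hv; rewrite raddfB; exact: homogB.
by move=> i j u v _ hu _ hv; rewrite lie_map_br; exact: homog_br.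
Qed.

(* Lie_{m,n}(A,B): the Lie ring freely generated by A in degree (1,0) and B in
   degree (0,1), that is, the free Lie ring on the direct sum of A and B *)
Definition lie_bideg (A B : zmodType) (m n : nat) : zmodType :=
  lie_comp (fun (i : nat * nat) (c : A * B) =>
    i = (1, 0)%N /\ c.2 = 0 \/ i = (0, 1)%N /\ c.1 = 0) (m, n).

Section Tensor.
Variables U V : zmodType.

Inductive tterm : Type :=
  | TPure of U & V
  | TZero
  | TOpp of tterm
  | TAdd of tterm & tterm.

HB.instance Definition _ := gen_eqMixin tterm.
HB.instance Definition _ := gen_choiceMixin tterm.

Inductive tens_eq : tterm -> tterm -> Prop :=
  | tens_refl s : tens_eq s s
  | tens_sym s t : tens_eq s t -> tens_eq t s
  | tens_trans t s r : tens_eq s t -> tens_eq t r -> tens_eq s r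
  | tens_congN s s' : tens_eq s s' -> tens_eq (TOpp s) (TOpp s')
  | tens_congD s s' t t' : tens_eq s s' -> tens_eq t t' ->
      tens_eq (TAdd s t) (TAdd s' t')
  | tens_addA s t r : tens_eq (TAdd s (TAdd t r)) (TAdd (TAdd s t) r)
  | tens_addC s t : tens_eq (TAdd s t) (TAdd t s)
  | tens_add0 s : tens_eq (TAdd TZero s) s
  | tens_addN s : tens_eq (TAdd (TOpp s) s) TZero
  | tens_Dl u u' v : tens_eq (TPure (u + u') v) (TAdd (TPure u v) (TPure u' v))
  | tens_Dr u v v' : tens_eq (TPure u (v + v')) (TAdd (TPure u v) (TPure u v')).

Definition tens_equiv := PEquiv tens_refl tens_sym tens_trans.

Definition tensor : Type := pquot tens_equiv.
HB.instance Definition _ := Choice.on tensor.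

Let q : tterm -> tensor := cls tens_equiv.
Let qP u v : q u = q v <-> tens_eq u v. Proof. exact: clsP. Qed.
Let qW (P : tensor -> Prop) : (forall u, P (q u)) -> forall u, P u.
Proof. exact: pquotW. Qed.
Let qrep u : tens_eq (rep (q u)) u. Proof. exact: (rep_cls tens_equiv). Qed.

Definition tpure (u : U) (v : V) : tensor := q (TPure u v).
Definition tzero : tensor := q TZero.
Definition topp (s : tensor) : tensor := q (TOpp (rep s)).
Definition tadd (s t : tensor) : tensor := q (TAdd (rep s) (rep t)).

Let oppE u : topp (q u) = q (TOpp u).
Proof. by apply/qP/tens_congN/qrep. Qed.
Let addE u v : tadd (q u) (q v) = q (TAdd u v).
Proof. by apply/qP/tens_congD; exact/qrep. Qed.

Fact tensorA : associative tadd.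
Proof.
by elim/qW=> u; elim/qW=> v; elim/qW=> w; rewrite !addE; apply/qP/tens_addA.
Qed.
Fact tensorC : commutative tadd.
Proof. by elim/qW=> u; elim/qW=> v; rewrite !addE; apply/qP/tens_addC. Qed.
Fact tensor0 : left_id tzero tadd.
Proof. by elim/qW=> u; rewrite !addE; apply/qP/tens_add0. Qed.
Fact tensorN : left_inverse tzero topp tadd.
Proof. by elim/qW=> u; rewrite oppE !addE; apply/qP/tens_addN. Qed.

HB.instance Definition _ :=
  GRing.isZmodule.Build tensor tensorA tensorC tensor0 tensorN.

Let qD u v : q u + q v = q (TAdd u v). Proof. exact: addE. Qed.
Let qN u : - q u = q (TOpp u). Proof. exact: oppE. Qed.

Lemma tpureDl u u' v : tpure (u + u') v = tpure u v + tpure u' v.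
Proof. by rewrite [RHS]qD; apply/qP/tens_Dl. Qed.

Lemma tpureDr u v v' : tpure u (v + v') = tpure u v + tpure u v'.
Proof. by rewrite [RHS]qD; apply/qP/tens_Dr. Qed.

Section Lift.
Variables (W : zmodType) (b : U -> V -> W).

Fixpoint tens_eval (s : tterm) : W :=
  match s with
  | TPure u v => b u v
  | TZero => 0
  | TOpp s => - tens_eval s
  | TAdd s t => tens_eval s + tens_eval t
  end.

(* For biadditive [b], the homomorphism sending [tpure u v] to [b u v] *)
Definition tens_lift (s : tensor) : W := tens_eval (rep s).

Hypothesis bDl : forall u u' v, b (u + u') v = b u v + b u' v.
Hypothesis bDr : forall u v v', b u (v + v') = b u v + b u v'.

Lemma tens_eval_eq s t : tens_eq s t -> tens_eval s = tens_eval t.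
Proof.
elim=> //=.
- by move=> ? ? ? _ -> _ ->.
- by move=> ? ? _ ->.
- by move=> ? ? ? ? _ -> _ ->.
- by move=> *; rewrite addrA.
- by move=> *; rewrite addrC.
- by move=> *; rewrite add0r.
- by move=> *; rewrite addNr.
Qed.

Lemma tens_liftE u v : tens_lift (tpure u v) = b u v.
Proof. exact: tens_eval_eq (qrep (TPure u v)). Qed.

Lemma tens_liftB : {morph tens_lift : s t / s - t}.
Proof.
have liftE s : tens_lift (q s) = tens_eval s := tens_eval_eq (qrep s).
by elim/qW=> s; elim/qW=> t; rewrite qN qD !liftE.
Qed.

End Lift.

End Tensor.

Definition tens_map (U U' V V' : zmodType) (f : U -> U') (g : V -> V')
    (s : tensor U V) : tensor U' V' :=
  tens_lift (fun u v => tpure (f u) (g v)) s.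

(* The bracket map C (x) L -> Lie(C'), c (x) u |-> [f c, u], for L a subgroup of
   Lie(C') and f : C -> C' *)
Definition bracket_map (C C' : zmodType) (f : C -> C') (I : nmodType)
    (gr : I -> C' -> Prop) (i : I) (s : tensor C (lie_comp gr i)) : free_lie C' :=
  tens_lift (fun c u => lie_br (lie_gen (f c)) (val u)) s.

Lemma bracket_mapE (C C' : zmodType) (f : {additive C -> C'}) (I : nmodType)
    (gr : I -> C' -> Prop) (i : I) (c : C) (u : lie_comp gr i) :
  bracket_map f (tpure c u) = lie_br (lie_gen (f c)) (val u).
Proof.
apply: tens_liftE => [c1 c2 v|c1 v1 v2].
  by rewrite raddfD lie_gD lie_Dbr.
by rewrite raddfD lie_brD.
Qed.

(* D_k(C) as a subset of C (x) Lie_{k+1}(C) *)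
Definition Dgrp (C : zmodType) (k : nat) : set (tensor C (lie_deg C k.+1)) :=
  [set s | bracket_map id s = 0].

(* D_{m,n}(A,B) for m, n >= 0 as a subset of
   (A (x) Lie_{m,n+1}(A,B)) (+) (B (x) Lie_{m+1,n}(A,B)) *)
Definition Dgrp2 (A B : zmodType) (m n : nat) :
    set (tensor A (lie_bideg A B m n.+1) * tensor B (lie_bideg A B m.+1 n)) :=
  [set s | bracket_map (fun a : A => (a, 0) : A * B) s.1 +
           bracket_map (fun b : B => (0, b) : A * B) s.2 = 0].

Section Heegaard.
Variables (R : realType) (g : nat).

(* S^3 as R^3 with a point at infinity *)
Definition S3 : topologicalType := one_point_compactification (R * R * R)%type.

(* The rectangle [0, 2g+1] x [0, 3] with the [g] open square holes
   ]2i+1, 2i+2[ x ]1, 2[ *)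
Definition holed_disk : set (R * R) := [set p |
  [/\ 0 <= p.1 <= (2 * g + 1)%:R, 0 <= p.2 <= 3 &
      forall i : 'I_g, ~ ((2 * i + 1)%:R < p.1 < (2 * i + 2)%:R /\
                          1 < p.2 < 2)]].

(* Its product with [0, 1] is an unknotted handlebody of genus [g] in R^3, whose
   closed complement in S^3 is the other handlebody of the standard splitting *)
Definition std_handlebody : set (R * R * R) :=
  [set p | holed_disk p.1 /\ 0 <= p.2 <= 1].

Definition HV : set S3 := Some @` std_handlebody.
Definition HV' : set S3 := closure (~` HV).
Definition HF : set S3 := HV `&` HV'.

(* A closed disk in the Heegaard surface, as an injective image of the closed
   unit disk; the base point of Sigma is the image of (1, 0) *)
Record disk := Disk {
  disk_map :> R * R -> S3;
  disk_cts : {within [set p | p.1 ^+ 2 + p.2 ^+ 2 <= 1], continuous disk_map};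
  disk_inj : forall p q, p.1 ^+ 2 + p.2 ^+ 2 <= 1 -> q.1 ^+ 2 + q.2 ^+ 2 <= 1 ->
    disk_map p = disk_map q -> p = q;
  disk_in : forall p, p.1 ^+ 2 + p.2 ^+ 2 <= 1 -> HF (disk_map p) }.

Variable D : disk.

Definition Sigma_set : set S3 :=
  HF `\` D @` [set p | p.1 ^+ 2 + p.2 ^+ 2 < 1].
Definition Sigma_bdry : set S3 := D @` [set p | p.1 ^+ 2 + p.2 ^+ 2 = 1].

Lemma Sigma_bdry_sub : Sigma_bdry `<=` Sigma_set.
Proof.
move=> _ [p /= p1 <-]; split; first by apply: disk_in; rewrite p1.
move=> [q /= q1 qp]; have qpE : q = p.
  by apply: (@disk_inj D) => //; [exact: ltW|rewrite p1].
by move: q1; rewrite qpE p1 ltxx.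
Qed.

Lemma Sigma_base_bdry : Sigma_bdry (D (1, 0)).
Proof. by exists (1, 0) => //=; rewrite expr1n expr0n addr0. Qed.

Definition Sigma : bordered S3 :=
  @Bordered S3 (BSet (Sigma_bdry_sub Sigma_base_bdry)) Sigma_bdry
    Sigma_bdry_sub Sigma_base_bdry.

Lemma Sigma_in_V x : carrier Sigma x -> HV x.
Proof. by case=> -[]. Qed.
Lemma Sigma_in_V' x : carrier Sigma x -> HV' x.
Proof. by case=> -[]. Qed.

Definition bV : bset S3 := BSet (Sigma_in_V (base_in Sigma)).
Definition bV' : bset S3 := BSet (Sigma_in_V' (base_in Sigma)).

Definition incl_V : bmap Sigma bV :=
  BMap (B := bV) (continuous_subspaceT (@id_cts S3)) Sigma_in_V erefl.
Definition incl_V' : bmap Sigma bV' :=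
  BMap (B := bV') (continuous_subspaceT (@id_cts S3)) Sigma_in_V' erefl.

Definition bdry_param (t : R) : R * R := (cos (2 * pi * t), sin (2 * pi * t)).

Lemma bdry_param_norm t : (bdry_param t).1 ^+ 2 + (bdry_param t).2 ^+ 2 = 1.
Proof. exact: cos2Dsin2. Qed.

Lemma bdry_loop_cts : {within I01, continuous (D \o bdry_param)}.
Proof.
apply: (within_comp_cont _ (@disk_cts D)).
  have c2 : continuous (fun t : R => 2 * pi * t) by cts.
  apply: pair_cts; apply: (comp_cts c2).
    exact: continuous_cos.
  exact: continuous_sin.
by move=> t _ /=; rewrite (bdry_param_norm t).
Qed.

Lemma bdry_loop_in t : I01 t -> carrier Sigma ((D \o bdry_param) t).
Proof.
by move=> _; apply: Sigma_bdry_sub; exists (bdry_param t) => //; exact: bdry_param_norm.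
Qed.

Lemma bdry_loop0 : (D \o bdry_param) 0 = base Sigma.
Proof. by rewrite /= /bdry_param mulr0 cos0 sin0. Qed.

Lemma bdry_loop1 : (D \o bdry_param) 1 = base Sigma.
Proof.
rewrite /= /bdry_param mulr1 mulr_natl -[pi *+ 2]add0r.
by rewrite cosD2pi sinD2pi cos0 sin0.
Qed.

Definition bdry_loop : loop R Sigma :=
  Loop bdry_loop_cts bdry_loop_in bdry_loop0 bdry_loop1.

Definition Kgrp : groupType := pi1 R Sigma.
Definition Mgrp : groupType := mcg R Sigma.

Definition pi1_V : Kgrp -> pi1 R bV := pi1_map incl_V.
Definition pi1_V' : Kgrp -> pi1 R bV' := pi1_map incl_V'.
HB.instance Definition _ := UMagmaMorphism.on pi1_V.
HB.instance Definition _ := UMagmaMorphism.on pi1_V'.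

Definition Xbar : set Kgrp := [set k | pi1_V k = 1%g].
Definition Ybar : set Kgrp := [set k | pi1_V' k = 1%g].

(* H_1 of a path-connected space is the abelianized fundamental group *)
Definition H1S : zmodType := abelianization Kgrp.
Definition H1A : zmodType := kernel (abmap pi1_V).
Definition H1B : zmodType := kernel (abmap pi1_V').

(* The meridians [mx i] and parallels [my i], with the properties through which
   they enter: they freely generate K, the boundary word, the kernels to the
   two handlebodies, and the resulting splitting of the homology *)
Record marking := Marking {
  mx : 'I_g -> Kgrp;
  my : 'I_g -> Kgrp;
  mark_free : free_basis (fun i : 'I_g + 'I_g =>
    match i with inl i => mx i | inr i => my i end);
  mark_bdry : ((hclass bdry_loop)^-1)%g =
    (\prod_(i < g) gcomm ((mx i)^-1) ((my i)^-1))%g;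
  mark_X : Xbar = normal_closure (range mx);
  mark_Y : Ybar = normal_closure (range my);
  mark_sum : forall u : H1S, exists! p : H1A * H1B, u = val p.1 + val p.2 }.

Definition Kmn : nat -> nat -> set Kgrp := dlcs Xbar Ybar.
Definition Kz : int -> int -> set Kgrp := dlcsz Xbar Ybar.
Definition GammaK : nat -> set Kgrp := Gamma [set: Kgrp].

Definition mcomm (h : Mgrp) (k : Kgrp) : Kgrp := (mcg_act h k * k^-1)%g.

Definition Mfil (m n : int) : set Mgrp := [set h |
  (forall k, Kz 1 0 k ->
    Kz (m + 1) n (mcomm h k) /\ Kz (m + 1) n (mcomm h^-1%g k)) /\
  (forall k, Kz 0 1 k ->
    Kz m (n + 1) (mcomm h k) /\ Kz m (n + 1) (mcomm h^-1%g k))].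

Definition Jfil (k : nat) : set Mgrp :=
  [set h | forall z, GammaK k.+1 (mcomm h z)].

Section Johnson.
Variable s : marking.

Lemma mx_in i : abclass (mx s i) \in ker_pred (abmap pi1_V).
Proof.
have : Xbar (mx s i) by rewrite (mark_X s); apply: sub_gen_smallest; exists i.
by move=> h; apply/eqP; apply: etrans (abmapE _ _) _; rewrite /= h.
Qed.

Lemma my_in i : abclass (my s i) \in ker_pred (abmap pi1_V').
Proof.
have : Ybar (my s i) by rewrite (mark_Y s); apply: sub_gen_smallest; exists i.
by move=> h; apply/eqP; apply: etrans (abmapE _ _) _; rewrite /= h.
Qed.

Definition aa (i : 'I_g) : H1A :=
  (Sub (abclass (mx s i)) (mx_in i) : kernel (abmap pi1_V)).
Definition bb (i : 'I_g) : H1B :=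
  (Sub (abclass (my s i)) (my_in i) : kernel (abmap pi1_V')).

(* The identification of Lie_k(H) with Gamma_k K / Gamma_{k+1} K as graded Lie
   rings, for k >= 1, given by the class maps [cl k : z |-> z Gamma_{k+1} K],
   which are meaningful on Gamma_k K only *)
Record lie_ident (cl : forall k, Kgrp -> lie_deg H1S k) : Prop := LieIdent {
  li_mul : forall k z w, (0 < k)%N -> GammaK k z -> GammaK k w ->
    cl k (z * w)%g = cl k z + cl k w;
  li_ker : forall k z, (0 < k)%N -> GammaK k z ->
    cl k z = 0 <-> GammaK k.+1 z;
  li_surj : forall k u, (0 < k)%N -> exists2 z, GammaK k z & cl k z = u;
  li_br : forall k l z w, (0 < k)%N -> (0 < l)%N -> GammaK k z -> GammaK l w ->
    val (cl (k + l)%N (gcomm z w)) = lie_br (val (cl k z)) (val (cl l w));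
  li_gen : forall z, val (cl 1%N z) = lie_gen (abclass z) }.

(* Likewise the identification of Lie_{m,n}(A,B) with K_{m,n} / K_{>(m,n)}, for
   (m,n) <> (0,0) *)
Record bilie_ident (cl : forall m n, Kgrp -> lie_bideg H1A H1B m n) : Prop :=
    BilieIdent {
  bli_mul : forall m n z w, (0 < m + n)%N -> Kmn m n z -> Kmn m n w ->
    cl m n (z * w)%g = cl m n z + cl m n w;
  bli_ker : forall m n z, (0 < m + n)%N -> Kmn m n z ->
    cl m n z = 0 <-> dlcs_gt Xbar Ybar m n z;
  bli_surj : forall m n u, (0 < m + n)%N ->
    exists2 z, Kmn m n z & cl m n z = u;
  bli_br : forall m n m' n' z w, (0 < m + n)%N -> (0 < m' + n')%N ->
    Kmn m n z -> Kmn m' n' w ->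
    val (cl (m + m')%N (n + n')%N (gcomm z w)) =
    lie_br (val (cl m n z)) (val (cl m' n' w));
  bli_genA : forall i, val (cl 1%N 0%N (mx s i)) = lie_gen (aa i, 0);
  bli_genB : forall i, val (cl 0%N 1%N (my s i)) = lie_gen (0, bb i) }.

Variable clH : forall k, Kgrp -> lie_deg H1S k.
Variable clAB : forall m n, Kgrp -> lie_bideg H1A H1B m n.

Definition tau (k : nat) (h : Mgrp) : tensor H1S (lie_deg H1S k.+1) :=
  \sum_(i < g) tpure (val (aa i)) (clH k.+1 (mcomm h (my s i))) -
  \sum_(i < g) tpure (val (bb i)) (clH k.+1 (mcomm h (mx s i))).

(* Ambient groups of the D_{m,n}(A,B): the value at (m,n) is the intended one
   when m, n >= -1 and m + n >= 1 *)
Definition Damb (m n : int) : zmodType :=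
  match m, n with
  | Posz m, Posz n => (tensor H1A (lie_bideg H1A H1B m n.+1) *
                       tensor H1B (lie_bideg H1A H1B m.+1 n))%type
  | Posz m, Negz _ => tensor H1A (lie_deg H1A m.-1.+1)
  | Negz _, Posz n => tensor H1B (lie_deg H1B n.-1.+1)
  | Negz _, Negz _ => int
  end.

Definition Dmn (m n : int) : set (Damb m n) :=
  match m, n return set (Damb m n) with
  | Posz m, Posz n => @Dgrp2 H1A H1B m n
  | Posz m, Negz _ => @Dgrp H1A m.-1
  | Negz _, Posz n => @Dgrp H1B n.-1
  | Negz _, Negz _ => setT
  end.

(* Lie_{p,q}(A,B) = K_{p,q}/K_{>(p,q)} -> Gamma_k K/Gamma_{k+1} K = Lie_k(H),
   z K_{>(p,q)} |-> z Gamma_{k+1} K, for k = p + q; under the identifications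
   it does not depend on the representative z and is additive *)
Definition gr_incl (p q k : nat) (u : lie_bideg H1A H1B p q) :
    lie_deg H1S k :=
  clH k (xget 1%g [set z | Kmn p q z /\ clAB p q z = u]).

(* The homomorphism j : D_{m,n}(A,B) -> D_k(H), for k = m + n *)
Definition jmap (m n : int) (k : nat) :
    Damb m n -> tensor H1S (lie_deg H1S k.+1) :=
  match m, n return Damb m n -> tensor H1S (lie_deg H1S k.+1) with
  | Posz m, Posz n => fun d =>
      tens_map (fun a : H1A => val a) (@gr_incl m n.+1 k.+1) d.1 +
      tens_map (fun b : H1B => val b) (@gr_incl m.+1 n k.+1) d.2
  | Posz m, Negz _ => tens_map (fun a : H1A => val a)
      (lie_deg_map (fun a : H1A => val a) m.-1.+1 k.+1)
  | Negz _, Posz n => tens_map (fun b : H1B => val b)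
      (lie_deg_map (fun b : H1B => val b) n.-1.+1 k.+1)
  | Negz _, Negz _ => fun=> 0
  end.

(* For n = -1 (resp. m = -1) the value is tau_{m-1}(h) (resp. tau_{n-1}(h))
   seen in the subgroup D_{m-1}(A) (resp. D_{n-1}(B)) of D_{m-1}(H)
   (resp. D_{n-1}(H)) *)
Definition taumn (m n : int) (h : Mgrp) : Damb m n :=
  match m, n return Damb m n with
  | Posz m, Posz n =>
      (\sum_(i < g) tpure (aa i) (clAB m n.+1 (mcomm h (my s i))),
       - \sum_(i < g) tpure (bb i) (clAB m.+1 n (mcomm h (mx s i))))
  | Posz m, Negz _ => xget 0 [set d | @Dgrp H1A m.-1 d /\
      tens_map (fun a : H1A => val a)
        (lie_deg_map (fun a : H1A => val a) m.-1.+1 m.-1.+1) d = tau m.-1 h]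
  | Negz _, Posz n => xget 0 [set d | @Dgrp H1B n.-1 d /\
      tens_map (fun b : H1B => val b)
        (lie_deg_map (fun b : H1B => val b) n.-1.+1 n.-1.+1) d = tau n.-1 h]
  | Negz _, Negz _ => 0
  end.

End Johnson.

End Heegaard.

(* Main.v *)
Require Import Defs.
From HB Require Import structures.
From mathcomp Require Import all_boot all_order all_algebra.
From mathcomp Require Import all_classical all_reals all_analysis.

(* The Johnson homomorphism takes values in the kernel of the bracket because a
   mapping class fixes the boundary loop: replacing x, y by ux, vy changes
   [x^-1,y^-1] by [x^-1,v^-1] and [u^-1,y^-1] to first order, so that the total
   change of the boundary word is the bracket of tau.  The two identifications
   of associated graded Lie rings agree on the generators, hence the map
   Lie_{m,n}(A,B) -> Lie_{m+n}(H) is the one induced by A (+) B -> H, which is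
   injective because the sum A + B = H is direct.  So the bracket of tau_{m,n}
   vanishes since that of tau_{m+n} does.  In the case n = -1 the classes that
   occur come from Gamma_m X, where iterated commutators of elements of X yield
   iterated brackets of elements of A; likewise for m = -1. *)

Set Implicit Arguments.
Unset Strict Implicit.
Unset Printing Implicit Defensive.

Import GRing.Theory.
Local Open Scope classical_set_scope.
Local Open Scope ring_scope.

Ltac group_norm :=
  rewrite /gcomm ?(invgM, invgK) ?mulgA ?(mulgK, mulgVK, mulgV, mulVg, mul1g, mulg1).

(** * Commutator subgroups, the lower central series and the double series *)

Section Subgroups.
Variable G : groupType.
Implicit Types (A B N M : set G) (a b : G).

Lemma is_subgroupV A a : is_subgroup A -> A a -> A (a^-1)%g.
Proof. by move=> [A1 AF] /(AF _ _ A1); rewrite mul1g. Qed.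

Lemma is_subgroupM A a b : is_subgroup A -> A a -> A b -> A (a * b)%g.
Proof.
by move=> sA Aa /(is_subgroupV sA) /(sA.2 _ _ Aa); rewrite invgK.
Qed.

Lemma generated_min A B : is_subgroup B -> A `<=` B -> generated A `<=` B.
Proof. exact: smallest_sub. Qed.

(** For fixed [b], the elements whose conjugate by [b] stays in [generated A] form a subgroup, and
    this subgroup contains [A]. *)
Lemma generated_normal A : (forall a b, A a -> A (b * a * b^-1)%g) ->
  is_normal_subgroup (generated A).
Proof.
move=> AJ; split; first exact: gen_subgroup.
move=> a b; move: a; apply: (@generated_min A [set a | generated A (b * a * b^-1)%g]).
  have [g1 gF] := gen_subgroup A.
  split=> /= [|a c ha hc]; first by rewrite mulg1 mulgV.
  suff -> : (b * (a * c^-1) * b^-1 = (b * a * b^-1) * (b * c * b^-1)^-1)%g.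
    exact: gF.
  by group_norm.
by move=> a Aa; apply: sub_gen_smallest; exact: AJ.
Qed.

Lemma mem_commutator A B a b : A a -> B b -> commutator_subgroup A B (gcomm a b).
Proof. by move=> Aa Bb; apply: sub_gen_smallest; exists a => //; exists b. Qed.

Lemma commutator_min A B M : is_subgroup M ->
  (forall a b, A a -> B b -> M (gcomm a b)) -> commutator_subgroup A B `<=` M.
Proof.
by move=> sM h; apply: generated_min => // _ [a Aa [b Bb <-]]; exact: h.
Qed.

Lemma commutatorS A A' B B' : A `<=` A' -> B `<=` B' ->
  commutator_subgroup A B `<=` commutator_subgroup A' B'.
Proof.
move=> AA BB; apply: commutator_min; first exact: gen_subgroup.
by move=> a b Aa Bb; apply: mem_commutator; [exact: AA|exact: BB].
Qed.

Lemma commutator_normal A B : is_normal_subgroup A -> is_normal_subgroup B ->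
  is_normal_subgroup (commutator_subgroup A B).
Proof.
move=> nA nB; apply: generated_normal => _ c [a Aa [b Bb <-]].
exists (c * a * c^-1)%g; first exact: nA.2.
by exists (c * b * c^-1)%g; [exact: nB.2|group_norm].
Qed.

Lemma commutator_subr A B : is_normal_subgroup B -> commutator_subgroup A B `<=` B.
Proof.
move=> [sB nB]; apply: commutator_min => // a b _ Bb.
by apply: sB.2 => //; exact: nB.
Qed.

Lemma set_prod_normal A B : is_normal_subgroup A -> is_normal_subgroup B ->
  is_normal_subgroup (set_prod A B).
Proof.
move=> [sA nA] [sB nB]; split; last first.
  move=> _ c [a Aa [b Bb <-]]; exists (c * a * c^-1)%g; first exact: nA.
  by exists (c * b * c^-1)%g; [exact: nB|group_norm].
split; first by exists 1%g; [exact: sA.1|exists 1%g; [exact: sB.1|rewrite mulg1]].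
move=> _ _ [a Aa [b Bb <-]] [a' Aa' [b' Bb' <-]].
(* Moving [a'^-1] to the left past [b * b'^-1] conjugates it, and [A] is normal. *)
exists (a * ((b * b'^-1) * a'^-1 * (b * b'^-1)^-1))%g.
  by apply: is_subgroupM => //; apply: nA; exact: is_subgroupV.
by exists (b * b'^-1)%g; [exact: sB.2|group_norm].
Qed.

Lemma set_prodl A B a : is_subgroup B -> A a -> set_prod A B a.
Proof. by move=> [B1 _] Aa; exists a => //; exists 1%g; rewrite ?mulg1. Qed.

Lemma set_prodr A B a : is_subgroup A -> B a -> set_prod A B a.
Proof. by move=> [A1 _] Ba; exists 1%g => //; exists a; rewrite ?mul1g. Qed.

Lemma set_prod_min A B M : is_subgroup M -> A `<=` M -> B `<=` M ->
  set_prod A B `<=` M.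
Proof.
by move=> sM AM BM _ [a /AM Ma [b /BM Mb <-]]; exact: is_subgroupM.
Qed.

Lemma normal_setT : is_normal_subgroup [set: G]. Proof. by split. Qed.

Lemma normal_closure_normal A : is_normal_subgroup (normal_closure A).
Proof.
split; last by move=> a b ga B BA; apply: BA.1.2; exact: ga.
split=> [B BA|a b ga gb B BA]; first exact: BA.1.1.1.
by apply: BA.1.1.2; [exact: ga|exact: gb].
Qed.

Lemma GammaE A k :
  Gamma A k.+2 = commutator_subgroup A (Gamma A k.+1).
Proof. by []. Qed.

Lemma Gamma_normal A k : is_normal_subgroup A -> is_normal_subgroup (Gamma A k).
Proof.
move=> nA; elim: k => [//|[//|k] IH]; exact: commutator_normal.
Qed.

Lemma GammaS A k : is_normal_subgroup A -> Gamma A k.+1 `<=` Gamma A k.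
Proof.
case: k => [|k] nA; first exact: subset_refl.
exact: (@commutator_subr A (Gamma A k.+1) (Gamma_normal k.+1 nA)).
Qed.

Lemma Gamma_decr A k l : is_normal_subgroup A -> (k <= l)%N ->
  Gamma A l `<=` Gamma A k.
Proof.
move=> nA /subnK <-; elim: (l - k)%N => [//|d IH]; apply: subset_trans IH.
by rewrite addSn; exact: GammaS.
Qed.

Lemma Gamma_mono A B k : A `<=` B -> Gamma A k `<=` Gamma B k.
Proof. by move=> AB; elim: k => [//|[//|k] IH]; exact: commutatorS. Qed.

Section DoubleSeries.
Variables (A B : set G) (nA : is_normal_subgroup A) (nB : is_normal_subgroup B).

Lemma dlcs_normal m n : is_normal_subgroup (dlcs A B m n).
Proof.
elim: m n => [[|n]|m IHm]; [exact: normal_setT|exact: Gamma_normal|].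
elim=> [|n IHn]; first exact: Gamma_normal.
rewrite dlcsS; apply: set_prod_normal; apply: commutator_normal => //.
Qed.

(** A commutator with [A] or [B] raises the weight [m + n] by one and is in particular a commutator
    with an element of the whole group. *)
Lemma dlcs_Gamma m n : dlcs A B m n `<=` Gamma setT (m + n).
Proof.
elim: m n => [[|n]|m IHm]; [by []|exact: Gamma_mono|].
elim=> [|n IHn]; first by rewrite addn0; exact: Gamma_mono.
rewrite dlcsS; apply: set_prod_min; first exact: (Gamma_normal _ normal_setT).1.
  by rewrite addSn addnS GammaE; apply: commutatorS;
  [exact: subsetT|rewrite -addnS; exact: IHm].
by rewrite addSn addnS GammaE; apply: commutatorS;
  [exact: subsetT|rewrite -addSn; exact: IHn].
Qed.

End DoubleSeries.

Section SubgroupType.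
Variables (A : set G) (sA : is_subgroup A).

(** The proof of [is_subgroup A] is an argument so that the group structure on [subgroup_type] can
    depend on it. *)
Definition subgroup_pred of is_subgroup A : {pred G} := mem A.

Lemma subgroup_group_closed : group_closed (subgroup_pred sA).
Proof.
split=> [|a b]; first by apply/mem_set; exact: sA.1.
by move=> /set_mem Aa /set_mem Ab; apply/mem_set; exact: sA.2.
Qed.

Definition subgroup_type : Type := {a : G | a \in subgroup_pred sA}.
HB.instance Definition _ := Choice.on subgroup_type.
HB.instance Definition _ := SubChoice.on subgroup_type.
HB.instance Definition _ := SubChoice_isSubGroup.Build G (subgroup_pred sA)
  subgroup_type subgroup_group_closed.

End SubgroupType.

(* The free generators define a map to the subgroup which, by uniqueness in the
   universal property, is a section of the inclusion. *)
Lemma free_basis_gen (I : Type) (e : I -> G) A : free_basis e ->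
  is_subgroup A -> (forall i, A (e i)) -> forall a, A a.
Proof.
move=> fe sA Ae a.
pose e' i : subgroup_type sA := Sub (e i) (mem_set (Ae i)).
have [phi [[phiM phie] _]] := fe _ e'.
have [psi [_ psiU]] := fe _ e.
have id_psi : psi = id by apply: psiU.
have phi_psi : psi = (fun a => val (phi a)).
  apply: psiU; split=> [b c|]; first by rewrite phiM.
  by apply/funext => i /=; rewrite -[phi (e i)]/((phi \o e) i) phie.
rewrite -[a]/(id a) -id_psi phi_psi; apply: set_mem; exact: (valP (phi a)).
Qed.

End Subgroups.

(** * Maps that are homomorphisms on a subgroup only *)

Section MultiplicativeMaps.
Variables (G : groupType) (V : zmodType) (N : set G) (sN : is_subgroup N).

(** The class maps are functions on all of K but are additive only on a term of a filtration. *)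
Definition mul_on (f : G -> V) := forall a b, N a -> N b -> f (a * b)%g = f a + f b.

Variables (f f' : G -> V) (fM : mul_on f) (f'M : mul_on f').

Lemma mul_on1 : f 1%g = 0.
Proof.
have := fM sN.1 sN.1; rewrite mulg1 => f1.
by apply: (@addrI _ (f 1%g)); rewrite -f1 addr0.
Qed.

Lemma mul_onV a : N a -> f (a^-1)%g = - f a.
Proof.
move=> Na; apply/eqP; rewrite -addr_eq0 -fM //; last exact: is_subgroupV.
by rewrite mulVg mul_on1.
Qed.

Lemma mul_onF a b : N a -> N b -> f (a * b^-1)%g = f a - f b.
Proof. by move=> Na Nb; rewrite fM ?mul_onV //; exact: is_subgroupV. Qed.

End MultiplicativeMaps.

(** This reduces the comparison of two class maps to generators of [N]. *)
Lemma mul_on_eq_subgroup (G : groupType) (V : zmodType) (N : set G)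
    (f f' : G -> V) : is_subgroup N -> mul_on N f -> mul_on N f' ->
  is_subgroup [set a | N a /\ f a = f' a].
Proof.
move=> sN fM f'M; split=> /=.
  by split; [exact: sN.1|rewrite (mul_on1 sN fM) (mul_on1 sN f'M)].
move=> a b [Na fa] [Nb fb]; split; first exact: sN.2.
by rewrite (mul_onF sN fM) // (mul_onF sN f'M) // fa fb.
Qed.

(** * Free Lie rings *)

Section FreeLie.
Variable C : zmodType.

(** The operations of [free_lie] act on chosen representatives; these are equivalent to the given
    terms, so induction on terms descends to the quotient. *)
Lemma free_lie_ind (P : free_lie C -> Prop) :
  (forall c, P (lie_gen c)) -> P 0 -> (forall u, P u -> P (- u)) ->
  (forall u v, P u -> P v -> P (u + v)) ->
  (forall u v, P u -> P v -> P (lie_br u v)) -> forall u, P u.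
Proof.
move=> Pg P0 PN PD PB; apply: pquotW.
have repE (u : lterm C) : lie_eq (rep (cls (lie_equiv C) u)) u.
  exact: (rep_cls (lie_equiv C)).
elim=> [c||u IHu|u IHu v IHv|u IHu v IHv].
- exact: Pg.
- exact: P0.
- suff -> : cls (lie_equiv C) (LOpp u) = - (cls (lie_equiv C) u : free_lie C).
    exact: PN.
  by apply/clsP/lie_congN/lie_sym/repE.
- suff -> : cls (lie_equiv C) (LAdd u v) =
      (cls (lie_equiv C) u : free_lie C) + cls (lie_equiv C) v by exact: PD.
  by apply/clsP/lie_congD; apply/lie_sym/repE.
- suff -> : cls (lie_equiv C) (LBr u v) =
      lie_br (cls (lie_equiv C) u) (cls (lie_equiv C) v) by exact: PB.
  by apply/clsP/lie_congB; apply/lie_sym/repE.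
Qed.

Lemma lie_brr0 (u : free_lie C) : lie_br u 0 = 0.
Proof.
by apply: (@addrI _ (lie_br u 0)); rewrite -lie_brD !addr0.
Qed.

Lemma lie_br0r (u : free_lie C) : lie_br 0 u = 0.
Proof.
by apply: (@addrI _ (lie_br 0 u)); rewrite -[LHS]lie_Dbr !addr0.
Qed.

Lemma lie_brN (u v : free_lie C) : lie_br u (- v) = - lie_br u v.
Proof.
by apply/eqP; rewrite -addr_eq0 -lie_brD addNr lie_brr0.
Qed.

Lemma lie_Nbr (u v : free_lie C) : lie_br (- u) v = - lie_br u v.
Proof.
apply/eqP; rewrite -addr_eq0.
by rewrite -[X in X == _](lie_Dbr v (- u) u) /= addNr lie_br0r.
Qed.

Lemma lie_gen0 : lie_gen (0 : C) = 0.
Proof.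
by apply: (@addrI _ (lie_gen 0)); rewrite -lie_gD !addr0.
Qed.

Lemma lie_genN (c : C) : lie_gen (- c) = - lie_gen c.
Proof.
by apply/eqP; rewrite -addr_eq0 -lie_gD addNr lie_gen0.
Qed.

End FreeLie.

(** The identity spreads from the generators. It turns a left inverse on groups into injectivity on
    free Lie rings. *)
Lemma lie_map_can (C C' : zmodType) (f : {additive C -> C'})
    (f' : {additive C' -> C}) : cancel f f' -> cancel (lie_map f) (lie_map f').
Proof.
move=> fK; apply: free_lie_ind => [c||u IH|u v IHu IHv|u v IHu IHv].
- by rewrite !lie_map_gen fK.
- by rewrite !raddf0.
- by rewrite !raddfN /= IH.
- by rewrite !raddfD /= IHu IHv.
- by rewrite !lie_map_br IHu IHv.
Qed.

(** * Tensor products and the bracket map on sums of pure tensors *)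

Section TensorLift.
Variables (U V W : zmodType) (b : U -> V -> W).
Hypothesis bDl : forall u u' v, b (u + u') v = b u v + b u' v.
Hypothesis bDr : forall u v v', b u (v + v') = b u v + b u v'.

Lemma tens_lift0 : tens_lift b 0 = 0.
Proof.
by have := tens_liftB bDl bDr 0 0; rewrite !subrr.
Qed.

Lemma tens_liftN : {morph tens_lift b : t / - t}.
Proof.
by move=> t; have := tens_liftB bDl bDr 0 t; rewrite !sub0r tens_lift0 sub0r.
Qed.

Lemma tens_liftD : {morph tens_lift b : t r / t + r}.
Proof.
move=> t r; rewrite -[r in LHS]opprK.
by rewrite (tens_liftB bDl bDr) tens_liftN opprK.
Qed.

Lemma tens_lift_sum (I : finType) (u : I -> U) (v : I -> V) :
  tens_lift b (\sum_i tpure (u i) (v i)) = \sum_i b (u i) (v i).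
Proof.
rewrite (big_morph _ tens_liftD tens_lift0).
by apply: eq_bigr => i _; rewrite tens_liftE.
Qed.

End TensorLift.

Section TensorMap.
Variables (U U' V V' : zmodType) (f : U -> U') (f' : V -> V').
Hypotheses (fD : {morph f : u v / u + v}) (f'D : {morph f' : u v / u + v}).

Let bDl u u' v : tpure (f (u + u')) (f' v) = tpure (f u) (f' v) + tpure (f u') (f' v).
Proof. by rewrite fD tpureDl. Qed.
Let bDr u v v' : tpure (f u) (f' (v + v')) = tpure (f u) (f' v) + tpure (f u) (f' v').
Proof. by rewrite f'D tpureDr. Qed.

Lemma tens_map_sum (I : finType) (u : I -> U) (v : I -> V) :
  tens_map f f' (\sum_i tpure (u i) (v i)) =
  \sum_i tpure (f (u i)) (f' (v i)).
Proof. exact: (tens_lift_sum bDl bDr). Qed.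

Lemma tens_mapN : {morph tens_map f f' : t / - t}.
Proof. exact: (tens_liftN bDl bDr). Qed.

End TensorMap.

Section BracketMap.
Variables (C C' : zmodType) (f : C -> C') (fD : {morph f : c d / c + d}).
Variables (I : nmodType) (gr : I -> C' -> Prop) (i : I).

Let bDl c c' (u : lie_comp gr i) : lie_br (lie_gen (f (c + c'))) (val u) =
  lie_br (lie_gen (f c)) (val u) + lie_br (lie_gen (f c')) (val u).
Proof. by rewrite fD lie_gD lie_Dbr. Qed.
Let bDr c (u u' : lie_comp gr i) : lie_br (lie_gen (f c)) (val (u + u')) =
  lie_br (lie_gen (f c)) (val u) + lie_br (lie_gen (f c)) (val u').
Proof. by rewrite raddfD lie_brD. Qed.

Lemma bracket_map_sum (J : finType) (c : J -> C) (u : J -> lie_comp gr i) :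
  bracket_map f (\sum_j tpure (c j) (u j)) =
  \sum_j lie_br (lie_gen (f (c j))) (val (u j)).
Proof. exact: (tens_lift_sum bDl bDr). Qed.

Lemma bracket_mapN : {morph @bracket_map C C' f I gr i : t / - t}.
Proof. exact: (tens_liftN bDl bDr). Qed.

Lemma bracket_mapD : {morph @bracket_map C C' f I gr i : t r / t + r}.
Proof. exact: (tens_liftD bDl bDr). Qed.

End BracketMap.

(** * The action on K and the bracket of the Johnson homomorphism *)

Section JohnsonHomomorphism.
Variables (R : realType) (g : nat) (D : disk R g) (s : marking D).

Local Notation K := (Kgrp D).
Local Notation HA := (H1A D).
Local Notation HB := (H1B D).
Local Notation HS := (H1S D).
Local Notation X := (@Xbar R g D).
Local Notation Y := (@Ybar R g D).

Lemma Xbar_normal : is_normal_subgroup X.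
Proof. by rewrite (mark_X s); exact: normal_closure_normal. Qed.

Lemma Ybar_normal : is_normal_subgroup Y.
Proof. by rewrite (mark_Y s); exact: normal_closure_normal. Qed.

Lemma Xbar_mx i : X (mx s i).
Proof. by rewrite (mark_X s); apply: sub_gen_smallest; exists i. Qed.

Lemma Ybar_my i : Y (my s i).
Proof. by rewrite (mark_Y s); apply: sub_gen_smallest; exists i. Qed.

Lemma GammaK_normal k : is_normal_subgroup (@GammaK R g D k).
Proof. exact/Gamma_normal/normal_setT. Qed.

Lemma GammaK_subgroup k : is_subgroup (@GammaK R g D k).
Proof. by have [] := GammaK_normal k. Qed.

Lemma GammaKS k z : @GammaK R g D k.+1 z -> @GammaK R g D k z.
Proof. exact: (@GammaS K setT k (normal_setT K)). Qed.

Lemma Kmn_normal m n : is_normal_subgroup (@Kmn R g D m n).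
Proof. exact: dlcs_normal Xbar_normal Ybar_normal m n. Qed.

Lemma Kmn_subgroup m n : is_subgroup (@Kmn R g D m n).
Proof. by have [] := Kmn_normal m n. Qed.

Lemma Kmn_GammaK m n : @Kmn R g D m n `<=` @GammaK R g D (m + n).
Proof. exact: dlcs_Gamma. Qed.

Lemma marking_ind (P : set K) : is_subgroup P ->
  (forall i, P (mx s i)) -> (forall i, P (my s i)) -> forall z, P z.
Proof.
by move=> sP Px Py; apply: (free_basis_gen (mark_free s) sP) => -[].
Qed.

Lemma mcg_actM (h : Mgrp D) : {morph @mcg_act R _ (Sigma D) h : a b / (a * b)%g}.
Proof. exact: pi1_mapM. Qed.

Lemma mcg_act1 (h : Mgrp D) : @mcg_act R _ (Sigma D) h 1%g = 1%g.
Proof. exact: pi1_map1. Qed.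

Lemma mcg_actV (h : Mgrp D) (a : K) :
  @mcg_act R _ (Sigma D) h (a^-1)%g = ((@mcg_act R _ (Sigma D) h a)^-1)%g.
Proof. exact: (gmulfV (pi1_map (homeo_bmap (rep h)))). Qed.

(** A representing homeomorphism fixes every boundary point, so it fixes the loop itself and not
    only its homotopy class. *)
Lemma mcg_act_bdry (h : Mgrp D) :
  @mcg_act R _ (Sigma D) h (hclass (bdry_loop D)) = hclass (bdry_loop D).
Proof.
move: h; apply: mcgW => f; rewrite mcg_actE pi1_mapE.
apply/hclassP/homotopic_eq => t _ /=; apply: (hfun_bdry f).
by exists (bdry_param t) => //; exact: bdry_param_norm.
Qed.

Lemma mcommE (h : Mgrp D) (z : K) :
  @mcg_act R _ (Sigma D) h z = (mcomm h z * z)%g.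
Proof. by rewrite /mcomm mulgVK. Qed.

(** [mcomm h] is a crossed homomorphism: [[h,ab^-1]] is [[h,a]] times a conjugate of [[h,b]^-1].
    Membership of all [[h,z]] in [N] can thus be tested on the free basis. *)
Lemma mcomm_subgroup (h : Mgrp D) (N : set K) : is_normal_subgroup N ->
  is_subgroup [set z | N (mcomm h z)].
Proof.
move=> [sN nN]; split=> /=.
  by rewrite /mcomm mcg_act1 mulgV; exact: sN.1.
move=> a b Na Nb; suff -> : mcomm h (a * b^-1)%g =
    (mcomm h a * ((a * b^-1) * (mcomm h b)^-1 * (a * b^-1)^-1))%g.
  by apply: is_subgroupM => //; apply: nN; exact: is_subgroupV.
by rewrite /mcomm mcg_actM mcg_actV; group_norm.
Qed.

Lemma Jfil_marking (h : Mgrp D) k :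
  (forall i, @GammaK R g D k.+1 (mcomm h (mx s i))) ->
  (forall i, @GammaK R g D k.+1 (mcomm h (my s i))) -> Jfil k h.
Proof.
by move=> hx hy; apply: marking_ind => //; exact/mcomm_subgroup/GammaK_normal.
Qed.

Section Identification.
Variables (clH : forall k, K -> lie_deg HS k) (identH : lie_ident clH).

Lemma clH_mul k : (0 < k)%N -> mul_on (@GammaK R g D k) (clH k).
Proof. by move=> k0 z w; exact: li_mul. Qed.

Lemma clH_eq0 k z : (0 < k)%N -> @GammaK R g D k.+1 z -> clH k z = 0.
Proof.
move=> k0 hz; apply/(li_ker identH) => //.
exact: GammaKS.
Qed.

(** Conjugation changes [z] by the factor [[w,z]], which lies one step deeper and has class zero. *)
Lemma clH_conj k z w : (0 < k)%N -> @GammaK R g D k z ->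
  clH k (w * z * w^-1)%g = clH k z.
Proof.
move=> k0 kz; have kc : @GammaK R g D k.+1 (gcomm w z).
  by case: k k0 kz => // k _ kz; rewrite /GammaK GammaE; exact: mem_commutator.
rewrite (_ : (w * z * w^-1)%g = (gcomm w z * z)%g); last by group_norm.
by rewrite clH_mul // ?(clH_eq0 k0 kc) ?add0r //; exact: GammaKS.
Qed.

(** Congruence modulo [Gamma_k K] that remembers the class of the discrepancy, for computing to
    first order. *)
Definition differ k (a b : K) (c : lie_deg HS k) : Prop := exists n,
  [/\ @GammaK R g D k n, a = (n * b)%g & clH k n = c].

(** Moving the second discrepancy to the left of [b] replaces it by a conjugate, which has the same
    class. *)
Lemma differM k a b (c : lie_deg HS k) a' b' c' : (0 < k)%N ->
  differ a b c -> differ a' b' c' -> differ (a * a')%g (b * b')%g (c + c').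
Proof.
move=> k0 [n [kn -> <-]] [n' [kn' -> <-]].
have kJ : @GammaK R g D k (b * n' * b^-1)%g by apply: (GammaK_normal k).2.
exists (n * (b * n' * b^-1))%g; split.
- exact: is_subgroupM (GammaK_subgroup k) _ _.
- by group_norm.
- by rewrite clH_mul // clH_conj.
Qed.

(* With y' = vy, the identity behind this is
   [(ux)^-1,y'^-1] = (x^-1 [u^-1,y'^-1] x) [x^-1,y^-1] (y^-1 [x^-1,v^-1] y). *)
Lemma differ_gcomm k (x y u v : K) : (0 < k)%N ->
    @GammaK R g D k.+1 u -> @GammaK R g D k.+1 v -> exists2 c : lie_deg HS k.+2,
  differ (gcomm (u * x)^-1 (v * y)^-1)%g (gcomm x^-1 y^-1)%g c &
  val c = lie_br (lie_gen (abclass x)) (val (clH k.+1 v)) -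
          lie_br (lie_gen (abclass y)) (val (clH k.+1 u)).
Proof.
move=> k0 ku kv; pose y' := (v * y)%g.
have kuV := is_subgroupV (GammaK_subgroup k.+1) ku.
have kvV := is_subgroupV (GammaK_subgroup k.+1) kv.
have kcu w a : @GammaK R g D k.+1 a -> @GammaK R g D k.+2 (gcomm w a).
  by move=> ka; rewrite /GammaK GammaE; exact: mem_commutator.
(* The factor [[u^-1,y'^-1]] is [p^-1]; writing it through [p] puts the deep element second, as
   [brE] requires. *)
pose p := gcomm y'^-1%g u^-1%g; pose q := gcomm x^-1%g v^-1%g.
have kp : @GammaK R g D k.+2 p by exact: kcu.
have kq : @GammaK R g D k.+2 q by exact: kcu.
have kpV := is_subgroupV (GammaK_subgroup k.+2) kp.
(* Moved to the left of [[x^-1,y^-1]], the last factor [y^-1 q y] becomes [w q w^-1]. *)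
pose w := (gcomm x^-1 y^-1 * y^-1)%g.
have abN z : abclass (z^-1)%g = - abclass z :> HS.
  rewrite (mul_onV (f := abclass (G := K)) (normal_setT K).1) // => ? ? _ _.
  exact: abclassM.
(* Since [k] is positive, [v] lies in [Gamma_2 K] and vanishes in homology. *)
have aby : abclass y' = abclass y :> HS.
  rewrite abclassM; suff -> : abclass v = 0 :> HS by rewrite add0r.
  apply/abP; rewrite /ab_eq invg1 mulg1.
  exact: (@Gamma_decr K setT 2 k.+1 (normal_setT K)).
exists (clH k.+2 (p^-1)%g + clH k.+2 q).
  exists ((x^-1 * p^-1 * x^-1^-1) * (w * q * w^-1))%g; split.
  - by apply: is_subgroupM (GammaK_subgroup k.+2) _ _; apply: (GammaK_normal k.+2).2.
  - by rewrite /w /p /q /y'; group_norm.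
  - by rewrite clH_mul ?clH_conj //; apply: (GammaK_normal k.+2).2.
have brE a b : @GammaK R g D k.+1 b ->
    val (clH k.+2 (gcomm a^-1%g b^-1%g)) =
    lie_br (lie_gen (abclass a)) (val (clH k.+1 b)).
  move=> kb; have kbV := is_subgroupV (GammaK_subgroup k.+1) kb.
  rewrite (li_br identH (k := 1) (l := k.+1)) // (li_gen identH) abN lie_genN.
  by rewrite lie_Nbr (mul_onV (GammaK_subgroup k.+1) (clH_mul _)) // raddfN lie_brN opprK.
rewrite (mul_onV (GammaK_subgroup k.+2) (clH_mul _)) // addrC.
by rewrite raddfB /= !brE // aby.
Qed.

Lemma tau_bracket k (h : Mgrp D) : bracket_map id (tau s clH k h) =
  \sum_(i < g) lie_br (lie_gen (abclass (mx s i))) (val (clH k.+1 (mcomm h (my s i)))) -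
  \sum_(i < g) lie_br (lie_gen (abclass (my s i))) (val (clH k.+1 (mcomm h (mx s i)))).
Proof.
have idD : {morph id : u v / u + v :> HS} by [].
by rewrite /tau (bracket_mapD idD) (bracket_mapN idD) !(bracket_map_sum idD).
Qed.

(* [h] fixes the boundary loop, hence the product of the [[x_i^-1, y_i^-1]]. *)
Lemma tau_Dgrp k (h : Mgrp D) : (0 < k)%N -> Jfil k h -> Dgrp (tau s clH k h).
Proof.
move=> k0 hJ; rewrite /Dgrp /= tau_bracket.
have bP : (\prod_(i < g) gcomm ((mcomm h (mx s i) * mx s i)^-1)
     ((mcomm h (my s i) * my s i)^-1) =
   \prod_(i < g) gcomm ((mx s i)^-1) ((my s i)^-1))%g.
  rewrite -(mark_bdry s) -[in RHS](mcg_act_bdry h) -mcg_actV (mark_bdry s).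
  rewrite (big_morph _ (mcg_actM h) (mcg_act1 h)); apply: eq_bigr => i _.
  by rewrite /gcomm !mcg_actM !mcg_actV !mcommE.
pose P (i : 'I_g) (c : lie_deg HS k.+2) := differ
  (gcomm (mcomm h (mx s i) * mx s i)^-1 (mcomm h (my s i) * my s i)^-1)%g
  (gcomm (mx s i)^-1 (my s i)^-1)%g c /\ val c =
  lie_br (lie_gen (abclass (mx s i))) (val (clH k.+1 (mcomm h (my s i)))) -
  lie_br (lie_gen (abclass (my s i))) (val (clH k.+1 (mcomm h (mx s i)))).
have /choice[c cP] i : exists c, P i c.
  have [c c1 c2] := differ_gcomm (mx s i) (my s i) k0 (hJ (mx s i)) (hJ (my s i)).
  by exists c.
have : differ (\prod_(i < g) gcomm ((mcomm h (mx s i) * mx s i)^-1)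
     ((mcomm h (my s i) * my s i)^-1))%g
   (\prod_(i < g) gcomm ((mx s i)^-1) ((my s i)^-1))%g (\sum_(i < g) c i).
  apply: big_ind3 => [|? ? ? ? ? ?|i _]; last by case: (cP i).
    exists 1%g; split; rewrite ?mulg1 //; first exact: (GammaK_subgroup _).1.
    exact (mul_on1 (GammaK_subgroup k.+2) (@clH_mul k.+2 isT)).
  exact: differM.
case=> n [kn]; rewrite bP => e.
(* The two boundary words coincide, so their discrepancy is trivial and the classes [c i] sum to
   zero. *)
have {e}-> : n = 1%g.
  by apply: (mulIg (\prod_(i < g) gcomm (mx s i)^-1 (my s i)^-1)%g); rewrite mul1g -e.
rewrite (mul_on1 (GammaK_subgroup _) (clH_mul _)) // => /esym/(congr1 val).
rewrite raddf_sum raddf0 /= -sumrB; apply: etrans.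
by apply: eq_bigr => i _; have [_ ->] := cP i.
Qed.

End Identification.

End JohnsonHomomorphism.

(** * The splitting of H into A and B *)

Section DoubleJohnsonHomomorphism.
Variables (R : realType) (g : nat) (D : disk R g) (s : marking D).

Local Notation K := (Kgrp D).
Local Notation HA := (H1A D).
Local Notation HB := (H1B D).
Local Notation HS := (H1S D).
Local Notation X := (@Xbar R g D).
Local Notation Y := (@Ybar R g D).

Definition H1_sum (p : HA * HB) : HS := val p.1 + val p.2.

Lemma H1_sumB : {morph H1_sum : p q / p - q}.
Proof. by move=> [a b] [a' b']; rewrite /H1_sum /= opprD addrACA. Qed.
HB.instance Definition _ :=
  GRing.isZmodMorphism.Build (HA * HB)%type HS H1_sum H1_sumB.

(** The marking is an argument because its [mark_sum] provides the decomposition; the default [0] is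
    then never taken. *)
Definition H1_split of marking D : HS -> HA * HB :=
  fun u => xget 0 [set p | u = val p.1 + val p.2].

Lemma H1_splitK : cancel (H1_split s) H1_sum.
Proof.
move=> u; rewrite /H1_split.
by case: xgetP => [p _ /= ->|none]; [|have [p [/none]] := mark_sum s u].
Qed.

Lemma H1_sumK : cancel H1_sum (H1_split s).
Proof.
move=> p; have [q [_ qU]] := mark_sum s (H1_sum p).
apply: etrans (qU p erefl); apply/esym/qU.
exact: (esym (H1_splitK (H1_sum p))).
Qed.

Lemma H1_splitB : {morph H1_split s : u v / u - v}.
Proof.
by move=> u v; apply: (can_inj H1_sumK); rewrite H1_sumB !H1_splitK.
Qed.
HB.instance Definition _ :=
  GRing.isZmodMorphism.Build HS (HA * HB)%type (H1_split s) H1_splitB.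

(** Relations between brackets in Lie(A,B) can therefore be checked in Lie(H). *)
Lemma lie_map_H1_sum_inj : injective (lie_map H1_sum).
Proof. exact: can_inj (lie_map_can H1_sumK). Qed.

(** * Comparison of the bigraded classes with the graded ones *)

Section BiIdentification.
Variables (clH : forall k, K -> lie_deg HS k) (identH : lie_ident clH).
Variables (clAB : forall m n, K -> lie_bideg HA HB m n).
Hypothesis identAB : bilie_ident s clAB.

Lemma clAB_mul m n : (0 < m + n)%N -> mul_on (@Kmn R g D m n) (clAB m n).
Proof. by move=> mn z w; exact: (bli_mul identAB). Qed.

(** This is built into the recursion except at [(0,0)], where [[X,K]] lies in [X] by normality. *)
Lemma Kmn_gcommX m n z w : X w -> @Kmn R g D m n z -> @Kmn R g D m.+1 n (gcomm w z).
Proof.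
move=> Xw; case: m => [|m]; case: n => [|n] => hz.
- suff -> : gcomm w z = (w * (z * w^-1 * z^-1))%g.
    apply: is_subgroupM => //; first exact: (Xbar_normal s).1.
    by apply: (Xbar_normal s).2; apply: is_subgroupV => //; exact: (Xbar_normal s).1.
  by group_norm.
- rewrite /Kmn dlcsS; apply: set_prodl; first exact: gen_subgroup.
  exact: mem_commutator.
- exact: mem_commutator.
- rewrite /Kmn dlcsS; apply: set_prodl; first exact: gen_subgroup.
  exact: mem_commutator.
Qed.

Lemma Kmn_gcommY m n z w : Y w -> @Kmn R g D m n z -> @Kmn R g D m n.+1 (gcomm w z).
Proof.
move=> Yw; case: m => [|m]; case: n => [|n] => hz.
- suff -> : gcomm w z = (w * (z * w^-1 * z^-1))%g.
    apply: is_subgroupM => //; first exact: (Ybar_normal s).1.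
    by apply: (Ybar_normal s).2; apply: is_subgroupV => //; exact: (Ybar_normal s).1.
  by group_norm.
- exact: mem_commutator.
- rewrite /Kmn dlcsS; apply: set_prodr; first exact: gen_subgroup.
  exact: mem_commutator.
- rewrite /Kmn dlcsS; apply: set_prodr; first exact: gen_subgroup.
  exact: mem_commutator.
Qed.

Lemma clAB_eq0 m n z : (0 < m + n)%N -> @Kmn R g D m n z ->
  dlcs_gt X Y m n z -> clAB m n z = 0.
Proof. by move=> mn hz; move/(bli_ker identAB mn hz). Qed.

(** The [w] whose conjugation preserves [f] on [N] form a subgroup, so meridians and parallels
    suffice. *)
Lemma conj_invariant (N : set K) (V : zmodType) (f : K -> V) : is_normal_subgroup N ->
  (forall i z, N z -> f (mx s i * z * (mx s i)^-1)%g = f z) ->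
  (forall i z, N z -> f (my s i * z * (my s i)^-1)%g = f z) ->
  forall w z, N z -> f (w * z * w^-1)%g = f z.
Proof.
move=> [sN nN] fx fy.
apply: marking_ind => [|i z|i z]; [|exact: fx|exact: fy].
split=> [z _|a b fa fb z Nz]; first by rewrite mul1g invg1 mulg1.
have NbJ : N (b^-1 * z * b)%g by rewrite -[X in (_ * X)%g]invgK; exact: nN.
rewrite (_ : (a * b^-1 * z * (a * b^-1)^-1 = a * (b^-1 * z * b) * a^-1)%g).
  by rewrite fa // -(fb _ NbJ); congr f; group_norm.
by group_norm.
Qed.

Lemma clAB_conj_gcomm m n w z : (0 < m + n)%N -> @Kmn R g D m n z ->
  dlcs_gt X Y m n (gcomm w z) -> clAB m n (w * z * w^-1)%g = clAB m n z.
Proof.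
move=> mn hz gt; have sK := Kmn_subgroup s m n; have [_ nK] := Kmn_normal s m n.
have hc : @Kmn R g D m n (gcomm w z).
  rewrite /gcomm; apply: is_subgroupM => //; first exact: nK.
  exact: is_subgroupV.
rewrite (_ : (w * z * w^-1)%g = (gcomm w z * z)%g); last by group_norm.
by rewrite clAB_mul // clAB_eq0 // add0r.
Qed.

(** The commutator of [z] with a meridian lies in [K_{2,0}] and with a parallel in [K_{1,1}], the
    two factors of [K_{>(1,0)}]. *)
Lemma clAB_conjX w z : X z -> clAB 1 0 (w * z * w^-1)%g = clAB 1 0 z.
Proof.
move: w z; apply: conj_invariant (Xbar_normal s) _ _ => i z Xz.
  apply: clAB_conj_gcomm => //; apply: set_prodl; first exact: (Kmn_subgroup s 1 1).
  by apply: (@Kmn_gcommX 1 0) => //; exact: Xbar_mx.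
apply: clAB_conj_gcomm => //; apply: set_prodr; first exact: (Kmn_subgroup s 2 0).
by apply: (@Kmn_gcommY 1 0) => //; exact: Ybar_my.
Qed.

Lemma clAB_conjY w z : Y z -> clAB 0 1 (w * z * w^-1)%g = clAB 0 1 z.
Proof.
move: w z; apply: conj_invariant (Ybar_normal s) _ _ => i z Yz.
  apply: clAB_conj_gcomm => //; apply: set_prodl; first exact: (Kmn_subgroup s 0 2).
  by apply: (@Kmn_gcommX 0 1) => //; exact: Xbar_mx.
apply: clAB_conj_gcomm => //; apply: set_prodr; first exact: (Kmn_subgroup s 1 1).
by apply: (@Kmn_gcommY 0 1) => //; exact: Ybar_my.
Qed.

(** The two classes are compared in the whole free Lie ring on H, which avoids matching the types of
    their components. *)
Definition agree (m n : nat) : set K := [set z | @Kmn R g D m n z /\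
  lie_map H1_sum (val (clAB m n z)) = val (clH (m + n)%N z)].

Lemma agree_subgroup m n : (0 < m + n)%N -> is_subgroup (agree m n).
Proof.
move=> mn; apply: mul_on_eq_subgroup; first exact: Kmn_subgroup.
  by move=> a b ha hb; rewrite clAB_mul // !raddfD.
move=> a b /Kmn_GammaK ha /Kmn_GammaK hb.
by rewrite (clH_mul identH mn) // raddfD.
Qed.

(** Both identifications take commutators to brackets. *)
Lemma agree_gcomm m n m' n' a b : (0 < m + n)%N -> (0 < m' + n')%N ->
  agree m n a -> agree m' n' b ->
  @Kmn R g D (m + m') (n + n') (gcomm a b) -> agree (m + m') (n + n') (gcomm a b).
Proof.
move=> mn mn' [ha fa] [hb fb] hc; split=> //.
rewrite (bli_br identAB) // lie_map_br fa fb addnACA.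
by rewrite (li_br identH) //; exact: Kmn_GammaK.
Qed.

(** The classes are prescribed on the [x_i] only; conjugation invariance on both sides extends the
    agreement to their normal closure. *)
Lemma agree10 : X `<=` agree 1 0.
Proof.
have sA := @agree_subgroup 1 0 isT.
rewrite (mark_X s); apply: smallest_sub => [|_ [i _ <-]]; last first.
  split; first exact: Xbar_mx.
  by rewrite (bli_genA identAB) lie_map_gen /= /H1_sum /= addr0 (li_gen identH).
split=> // z w [Xz fz]; split; first exact: (Xbar_normal s).2.
by rewrite clAB_conjX // fz (clH_conj identH).
Qed.

Lemma agree01 : Y `<=` agree 0 1.
Proof.
have sA := @agree_subgroup 0 1 isT.
rewrite (mark_Y s); apply: smallest_sub => [|_ [i _ <-]]; last first.
  split; first exact: Ybar_my.
  by rewrite (bli_genB identAB) lie_map_gen /= /H1_sum /= add0r (li_gen identH).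
split=> // z w [Yz fz]; split; first exact: (Ybar_normal s).2.
by rewrite clAB_conjY // fz (clH_conj identH).
Qed.

Lemma agreeX m n : (0 < m + n)%N -> @Kmn R g D m n `<=` agree m n ->
  commutator_subgroup X (@Kmn R g D m n) `<=` agree m.+1 n.
Proof.
move=> mn IH; apply: commutator_min; first exact: agree_subgroup.
move=> a b Xa hb; exact: (@agree_gcomm 1 0 m n _ _ isT mn (agree10 Xa) (IH _ hb)
  (Kmn_gcommX Xa hb)).
Qed.

Lemma agreeY m n : (0 < m + n)%N -> @Kmn R g D m n `<=` agree m n ->
  commutator_subgroup Y (@Kmn R g D m n) `<=` agree m n.+1.
Proof.
move=> mn IH; apply: commutator_min; first by apply: agree_subgroup; rewrite addnS.
move=> a b Ya hb; exact: (@agree_gcomm 0 1 m n _ _ isT mn (agree01 Ya) (IH _ hb)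
  (Kmn_gcommY Ya hb)).
Qed.

(** The induction follows the recursion of the double series, whose terms beyond [X] and [Y] are
    built from commutators with [X] or [Y]. *)
Lemma Kmn_agree m n : (0 < m + n)%N -> @Kmn R g D m n `<=` agree m n.
Proof.
elim: m n => [|m IHm].
  elim=> [//|[|n] IHn _]; first exact: agree01.
  exact: (@agreeY 0 n.+1 isT (IHn isT)).
elim=> [|n IHn] _.
  case: m IHm => [_|m IHm]; first exact: agree10.
  exact: (@agreeX m.+1 0 isT (IHm 0%N isT)).
rewrite {1}/Kmn dlcsS; apply: set_prod_min; first exact: agree_subgroup.
  have mn : (0 < m + n.+1)%N by rewrite addnS.
  exact: (agreeX mn (IHm _ mn)).
exact: (@agreeY m.+1 n isT (IHn isT)).
Qed.

Lemma lie_map_clAB m n k z : k = (m + n)%N -> (0 < k)%N -> @Kmn R g D m n z ->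
  lie_map H1_sum (val (clAB m n z)) = val (clH k z).
Proof. by move=> -> mn /(Kmn_agree mn)[]. Qed.

(** All representatives of [u] have the same class in Lie(H), so the choice in [gr_incl] is
    harmless; surjectivity of [clAB] rules out the default. *)
Lemma gr_inclE m n k (u : lie_bideg HA HB m n) : k = (m + n)%N -> (0 < k)%N ->
  val (gr_incl clH clAB k u) = lie_map H1_sum (val u).
Proof.
move=> km k0; rewrite /gr_incl.
have [z hz <-] : exists2 z, @Kmn R g D m n z & clAB m n z = u.
  by apply: (bli_surj identAB); rewrite -km.
case: xgetP => [w _ [hw <-]|/(_ z) []//].
by rewrite (lie_map_clAB km).
Qed.

Lemma gr_inclD m n k : k = (m + n)%N -> (0 < k)%N ->
  {morph @gr_incl R g D clH clAB m n k : u v / u + v}.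
Proof.
by move=> km k0 u v; apply: val_inj; rewrite gr_inclE // !raddfD /= !gr_inclE.
Qed.

Lemma gr_incl_clAB m n k z : k = (m + n)%N -> (0 < k)%N -> @Kmn R g D m n z ->
  gr_incl clH clAB k (clAB m n z) = clH k z.
Proof.
by move=> km k0 hz; apply: val_inj; rewrite gr_inclE // (lie_map_clAB km).
Qed.

End BiIdentification.

Lemma tpure0 (u : HS) k : tpure u (0 : lie_deg HS k) = 0.
Proof. by apply: (@addrI _ (tpure u 0)); rewrite -tpureDr !addr0. Qed.

Lemma tpureN (u : HS) k (v : lie_deg HS k) : tpure u (- v) = - tpure u v.
Proof. by apply/eqP; rewrite -addr_eq0 -tpureDr addNr tpure0. Qed.

(** * Lifting classes of [Gamma_k X] and [Gamma_k Y] to Lie(A) and Lie(B) *)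

Section Lifting.
Variables (C : zmodType) (f : {additive C -> HS}) (r : {additive HS -> C}).
Hypothesis fK : cancel f r.
Variables (clH : forall k, K -> lie_deg HS k) (identH : lie_ident clH).
Variables (A : set K) (nA : is_normal_subgroup A).
Hypothesis Af : forall a, A a -> exists c, f c = abclass a.

Lemma Gamma_lie_lift k z : (0 < k)%N -> Gamma A k z ->
  exists w : lie_deg C k, lie_map f (val w) = val (clH k z).
Proof.
(* Membership in [Gamma A k] is carried along because [clH k] is additive only on [Gamma_k K];
   [k = 0] is split off because [Gamma A 0] is a dummy. *)
move=> + kz; suff : k = 0%N \/ (Gamma A k z /\
    exists w : lie_deg C k, lie_map f (val w) = val (clH k z)) by case=> [->|[]].
elim: k z kz => [|[|k] IH] z kz; [by left|right|right].
  split=> //; have [c cz] := Af kz.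
  exists (Sub (lie_gen c) (asboolT (homog_gen (erefl 1%N)))).
  by rewrite /= lie_map_gen cz (li_gen identH).
pose L (z : K) := exists w : lie_deg C k.+2, lie_map f (val w) = val (clH k.+2 z).
have GK l : Gamma A l `<=` @GammaK R g D l by apply: Gamma_mono.
have sL : is_subgroup [set z | Gamma A k.+2 z /\ L z].
  have sG := (Gamma_normal k.+2 nA).1.
  have clM := clH_mul identH (ltn0Sn k.+1).
  split=> /=.
    split; first exact: sG.1.
    by exists 0; rewrite raddf0 (mul_on1 (GammaK_subgroup D k.+2) clM).
  move=> a b [Ga [u ua]] [Gb [v vb]]; split; first exact: sG.2.
  exists (u - v); rewrite !raddfB /= ua vb.
  by rewrite (mul_onF (GammaK_subgroup D k.+2) clM) ?raddfB //; exact: GK.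
move: z kz; rewrite GammaE; apply: (commutator_min sL) => a b Aa Gb.
split; first exact: mem_commutator.
have [c ca] := Af Aa; have [//|[_ [w wb]]] := IH _ Gb.
exists (Sub (lie_br (lie_gen c) (val w))
  (asboolT (homog_br (homog_gen (erefl 1%N)) (asboolW (valP w))))).
rewrite /= lie_map_br lie_map_gen wb ca -(li_gen identH).
by rewrite (li_br identH (k := 1) (l := k.+1)) //; exact: GK.
Qed.

Lemma lie_deg_mapD k : {morph @lie_deg_map C HS f k k : u v / u + v}.
Proof.
by move=> u v; apply: val_inj; rewrite lie_deg_mapE !raddfD /= !lie_deg_mapE.
Qed.

(** When an index is -1, [taumn] is picked by [xget]; this supplies an element meeting its
    specification, by lifting each class separately. *)
Lemma Dgrp_lift k (c : 'I_g -> C) (z : 'I_g -> K)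
    (T : tensor HS (lie_deg HS k.+1)) :
  (forall i, Gamma A k.+1 (z i)) ->
  T = \sum_(i < g) tpure (f (c i)) (clH k.+1 (z i)) -> Dgrp T ->
  exists d, @Dgrp C k d /\ tens_map f (lie_deg_map f k.+1 k.+1) d = T.
Proof.
move=> Gz TE DT.
have /choice[w wE] i := Gamma_lie_lift (ltn0Sn k) (Gz i).
exists (\sum_(i < g) tpure (c i) (w i)); split.
  (* [lie_map f] is injective thanks to [r], so the bracket of the lift may be computed in Lie(H),
     where it is that of [T]. *)
  apply: (can_inj (lie_map_can fK)); rewrite raddf0.
  apply: etrans DT; rewrite TE !bracket_map_sum // raddf_sum.
  by apply: eq_bigr => i _; rewrite /= lie_map_br lie_map_gen wE.
rewrite tens_map_sum ?TE; [|exact: raddfD|exact: lie_deg_mapD].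
by apply: eq_bigr => i _; congr tpure; apply: val_inj; rewrite lie_deg_mapE.
Qed.

End Lifting.

Lemma Xbar_kernel a : X a -> exists c : HA, val c = abclass a.
Proof.
move=> Xa; have ha : abclass a \in ker_pred (abmap (@pi1_V R g D)).
  by apply/eqP; apply: etrans (abmapE _ _) _; rewrite /= Xa.
by exists (Sub (abclass a) ha : Defs.kernel (abmap (@pi1_V R g D))).
Qed.

Lemma Ybar_kernel a : Y a -> exists c : HB, val c = abclass a.
Proof.
move=> Ya; have ha : abclass a \in ker_pred (abmap (@pi1_V' R g D)).
  by apply/eqP; apply: etrans (abmapE _ _) _; rewrite /= Ya.
by exists (Sub (abclass a) ha : Defs.kernel (abmap (@pi1_V' R g D))).
Qed.

(** The two projections serve as the left inverse [r] in [Dgrp_lift]. *)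
Definition H1_projA (t : marking D) (u : HS) : HA := (H1_split t u).1.
Definition H1_projB (t : marking D) (u : HS) : HB := (H1_split t u).2.

Lemma H1_projA_B : {morph H1_projA s : u v / u - v}.
Proof. by move=> u v; rewrite /H1_projA raddfB. Qed.
HB.instance Definition _ :=
  GRing.isZmodMorphism.Build HS HA (H1_projA s) H1_projA_B.

Lemma H1_projB_B : {morph H1_projB s : u v / u - v}.
Proof. by move=> u v; rewrite /H1_projB raddfB. Qed.
HB.instance Definition _ :=
  GRing.isZmodMorphism.Build HS HB (H1_projB s) H1_projB_B.

Lemma H1_projAK : cancel (val : HA -> HS) (H1_projA s).
Proof.
by move=> a; rewrite /H1_projA -[val a]addr0 -(raddf0 (val : HB -> HS)) (H1_sumK (a, 0)).
Qed.

Lemma H1_projBK : cancel (val : HB -> HS) (H1_projB s).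
Proof.
by move=> b; rewrite /H1_projB -[val b]add0r -(raddf0 (val : HA -> HS)) (H1_sumK (0, b)).
Qed.

End DoubleJohnsonHomomorphism.

(** * The commutative diagram *)

Theorem proposition5p6 (R : realType) (g : nat) (D : disk R g) (s : marking D)
  (clH : forall k : nat, Kgrp D -> lie_deg (H1S D) k)
  (clAB : forall m n : nat, Kgrp D -> lie_bideg (H1A D) (H1B D) m n)
  (identH : lie_ident clH) (identAB : bilie_ident s clAB)
  (m n : int) (hm : -1 <= m) (hn : -1 <= n) (hmn : 1 <= m + n)
  (h : Mgrp D) (hM : Mfil m n h) :
  [/\ Jfil (absz (m + n)) h,
      Dmn (taumn s clH clAB m n h),
      Dgrp (tau s clH (absz (m + n)) h) &
      jmap clH clAB (absz (m + n)) (taumn s clH clAB m n h) =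
        tau s clH (absz (m + n)) h].
Proof.
have hMx i := (hM.1 _ (Xbar_mx s i : Kz 1 0 (mx s i))).1.
have hMy i := (hM.2 _ (Ybar_my s i : Kz 0 1 (my s i))).1.
(* [Negz 0] is -1. The bounds leave three cases: both indices nonnegative, [n = -1], and
   [m = -1]. *)
case: m n hm hn hmn {hM} hMx hMy => [m|[|m]] [n|[|n]] // _ _.
- move=> mn hMx hMy; rewrite -[absz _]/(m + n)%N.
  have {}mn : (0 < m + n)%N by [].
  have hx i : Kmn m.+1 n (mcomm h (mx s i)) by rewrite -addn1; exact: hMx.
  have hy i : Kmn m n.+1 (mcomm h (my s i)) by rewrite -addn1; exact: hMy.
  have hJ : Jfil (m + n) h.
    apply: (Jfil_marking (s := s)) => i; first exact: (Kmn_GammaK (hx i)).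
    by rewrite -addnS; exact: (Kmn_GammaK (hy i)).
  have DT := tau_Dgrp s identH mn hJ.
  have kx : (m + n).+1 = (m.+1 + n)%N by [].
  have ky : (m + n).+1 = (m + n.+1)%N by rewrite addnS.
  split=> //.
    (* Pushed to Lie(H), the bracket of [taumn] becomes that of [tau], which vanishes. *)
    apply: (lie_map_H1_sum_inj s); rewrite raddf0; apply: etrans DT.
    have injA_D : {morph (fun a : H1A D => (a, 0) : H1A D * H1B D) : u v / u + v}.
      by move=> u v; congr pair; rewrite addr0.
    have injB_D : {morph (fun b : H1B D => (0, b) : H1A D * H1B D) : u v / u + v}.
      by move=> u v; congr pair; rewrite addr0.
    rewrite tau_bracket raddfD /= (bracket_mapN injB_D) !bracket_map_sum //.
    rewrite raddfN !raddf_sum /=; congr (_ + _); apply: eq_bigr => i _.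
      rewrite lie_map_br lie_map_gen (lie_map_clAB identH identAB ky) //.
      by rewrite /= /H1_sum /= addr0.
    congr (- _); rewrite lie_map_br lie_map_gen (lie_map_clAB identH identAB kx) //.
    by rewrite /= /H1_sum /= add0r.
  have fA := gr_inclD identH identAB ky (ltn0Sn _).
  have fB := gr_inclD identH identAB kx (ltn0Sn _).
  have vA : {morph (fun a : H1A D => val a) : u v / u + v} by exact: raddfD.
  have vB : {morph (fun b : H1B D => val b) : u v / u + v} by exact: raddfD.
  rewrite /jmap /taumn (tens_mapN vB fB) (tens_map_sum vA fA) (tens_map_sum vB fB).
  by congr (_ - _); apply: eq_bigr => i _; rewrite (gr_incl_clAB identH identAB).
(* Case [n = -1]: the first index is now [m.+2], and negative second indices count as 0, so all
   [[h,x_i]] and [[h,y_i]] lie in the lower central series of [X]. *)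
- case: m => [|[|m]] // _ hMx hMy; rewrite -[absz _]/m.+1.
  have hx i : Gamma (@Xbar R g D) m.+3 (mcomm h (mx s i)).
    by rewrite -[m.+3]addn1; exact: hMx.
  have hy i : Gamma (@Xbar R g D) m.+2 (mcomm h (my s i)) := hMy i.
  have GX l : Gamma (@Xbar R g D) l `<=` @GammaK R g D l by apply: Gamma_mono.
  have hJ : Jfil m.+1 h.
    by apply: (Jfil_marking (s := s)) => i; [apply: GammaKS|]; exact: GX.
  have DT := tau_Dgrp s identH (ltn0Sn m) hJ.
  (* The [[h,x_i]] lie one step deeper than the degree [m.+2] of their classes, so the sum over the
     [b_i] vanishes. *)
  have TE : tau s clH m.+1 h =
      \sum_(i < g) tpure (val (aa s i)) (clH m.+2 (mcomm h (my s i))).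
    rewrite /tau [X in _ - X]big1 ?subr0 // => i _.
    by rewrite (clH_eq0 identH) ?tpure0 //; exact: GX.
  (* The defining property of the chosen element is exactly the commutativity claimed. *)
  have [Dd Ed] := xgetPex 0 (Dgrp_lift (@H1_projAK _ _ _ s) identH (Xbar_normal s)
    (@Xbar_kernel _ _ _) hy TE DT).
  by split.
case: n => [|[|n]] // _ hMx hMy; rewrite -[absz _]/n.+1.
have hx i : Gamma (@Ybar R g D) n.+2 (mcomm h (mx s i)) := hMx i.
have hy i : Gamma (@Ybar R g D) n.+3 (mcomm h (my s i)).
  by rewrite -[n.+3]addn1; exact: hMy.
have GY l : Gamma (@Ybar R g D) l `<=` @GammaK R g D l by apply: Gamma_mono.
have hJ : Jfil n.+1 h.
  by apply: (Jfil_marking (s := s)) => i; [|apply: GammaKS]; exact: GY.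
have DT := tau_Dgrp s identH (ltn0Sn n) hJ.
have sY : is_subgroup (Gamma (@Ybar R g D) n.+2).
  by have [] := Gamma_normal n.+2 (Ybar_normal s).
(* The sum over the [a_i] vanishes here. The sign of the other sum is absorbed by inverting
   [[h,x_i]], to reach the form that [Dgrp_lift] expects. *)
have TE : tau s clH n.+1 h =
    \sum_(i < g) tpure (val (bb s i)) (clH n.+2 (mcomm h (mx s i))^-1%g).
  rewrite /tau [X in X - _]big1 ?sub0r => [|i _]; last first.
    by rewrite (clH_eq0 identH) ?tpure0 //; exact: GY.
  rewrite -sumrN; apply: eq_bigr => i _; rewrite -tpureN.
  by rewrite (mul_onV (GammaK_subgroup D n.+2) (clH_mul identH (ltn0Sn _))) //; exact: GY.
have hxV i := is_subgroupV sY (hx i).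
have [Dd Ed] := xgetPex 0 (Dgrp_lift (@H1_projBK _ _ _ s) identH (Ybar_normal s)
  (@Ybar_kernel _ _ _) hxV TE DT).
by split.
Qed.
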